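(* Let $s,\varepsilon\in(0,\infty)$, $r\in\mathbb N$ with $r>s$, $f\in\Lambda_s$, and assume the regularity $L$ of the Daubechies wavelet system satisfies $L\ge r-1$ and $L>s$. Then there exist constants $c\in(0,1)$, $m\in\mathbb N$ and $R\in(1,\infty)$ (where $m$ and $R$ may depend on $f$ and $\varepsilon$) such that for every $j\in\mathbb Z_+$, $$S_{r,j}(s,f,\varepsilon)\subset\bigcup_{i=j-m}^{j+m}\big[T^0_i(s,f,c\varepsilon)\big]_R,$$ with the convention $T^0_i(s,f,c\varepsilon):=\emptyset$ for $i<0$.
   Context: $\Delta_hf(x):=f(x+h/2)-f(x-h/2)$, $\Delta^{k+1}_h:=\Delta^k_h\Delta_h$, $\Delta_rf(x,y):=\sup_{|h|=y}|\Delta_h^rf(x)|$. $\Lambda_s$: bounded continuous $f$ with $\|f\|_{L^\infty}+\sup_{x,\,y\in(0,1]}\Delta_{\lfloor s\rfloor+1}f(x,y)/y^s<\infty$. $S_{r,j}(s,f,\varepsilon):=\{(x,y)\in\mathbb R^n\times(0,\infty):\Delta_rf(x,y)/y^s>\varepsilon,\ y\in(2^{-j-1},2^{-j}]\}$. $\mathcal D_j=\{2^{-j}(k+[0,1)^n):k\in\mathbb Z^n\}$, $\mathcal D=\bigcup_{j\ge0}\mathcal D_j$; $T(I):=I\times(\ell(I)/2,\ell(I)]$. Daubechies wavelet system of regularity $L$ ($\varphi,\psi_\ell\in C^L_c$, $\ell=1,\dots,2^n-1$, vanishing moments up to order $L$, $\{\varphi(\cdot-k)\}\cup\{2^{jn/2}\psi_\ell(2^j\cdot-k)\}$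 orthonormal basis of $L^2$), indexed by $\Omega=\{0\}\times\mathcal D_0\cup\{1,\dots,2^n-1\}\times\mathcal D$ with $\psi_{(0,k+[0,1)^n)}=\varphi(\cdot-k)$, $\psi_{(\ell,2^{-j}(k+[0,1)^n))}=2^{jn/2}\psi_\ell(2^j\cdot-k)$, $I_{(\ell,I)}=I$. $W^0_i(s,f,\varepsilon):=\{I\in\mathcal D_i:\max_{\omega\in\Omega:I_\omega=I}|\int f\psi_\omega|>\varepsilon|I|^{s/n+1/2}\}$, $T^0_i(s,f,\varepsilon):=\bigcup_{I\in W^0_i(s,f,\varepsilon)}T(I)$. Hyperbolic metric $\rho(\mathbf x,\mathbf y)=\operatorname{arccosh}(1+\frac{|\mathbf x-\mathbf y|^2}{2x_{n+1}y_{n+1}})$; $A_R:=\{\mathbf x:\inf_{\mathbf y\in A}\rho(\mathbf x,\mathbf y)<R\}$. *)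

(* Defs.v *)
From HB Require Import structures.
From mathcomp Require Import all_boot all_order all_algebra.
From mathcomp Require Import all_classical all_reals all_analysis.
Set Implicit Arguments. Unset Strict Implicit. Unset Printing Implicit Defensive.
Import Order.TTheory GRing.Theory Num.Theory.
Import numFieldNormedType.Exports.
Local Open Scope classical_set_scope.
Local Open Scope ring_scope.

Section Defs.
Variables (R : realType) (n : nat).
Local Notation pt := 'rV[R]_n.

Definition enorm (x : pt) : R := Num.sqrt (\sum_(i < n) x ord0 i ^+ 2).

Definition sdiff (h : pt) (g : pt -> R) : pt -> R :=
  fun x => g (x + 2^-1 *: h) - g (x - 2^-1 *: h).
Definition sdiffn (r : nat) (h : pt) (g : pt -> R) : pt -> R := iter r (sdiff h) g.

Definition DeltaR (r : nat) (f : pt -> R) (x : pt) (y : R) : R :=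
  sup [set `|sdiffn r h f x| | h in [set h : pt | enorm h = y]].

Definition bounded_fun (f : pt -> R) : Prop := exists M : R, forall x, `|f x| <= M.

Definition in_Lambda (s : R) (f : pt -> R) : Prop :=
  continuous f /\ bounded_fun f /\
  exists C : R, forall (x : pt) (y : R), 0 < y <= 1 ->
     DeltaR (Num.truncn s).+1 f x y / y `^ s <= C.

Definition Sset (r j : nat) (s : R) (f : pt -> R) (eps : R) : set (pt * R) :=
  [set X | 0 < X.2 /\ DeltaR r f X.1 X.2 / X.2 `^ s > eps /\
           (2 ^- j.+1 < X.2 <= 2 ^- j)].

Definition setc (x : pt) (k : nat) (t : R) : pt :=
  \row_(i < n) (if (i : nat) == k then t else x ord0 i).
Fixpoint iterint (k : nat) (g : pt -> R) (x : pt) : R :=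
  match k with
  | 0 => g x
  | k'.+1 => Rintegral lebesgue_measure setT (fun t => iterint k' g (setc x k' t))
  end.
Definition intRn (g : pt -> R) : R := iterint n g 0.

Definition compact_support (g : pt -> R) : Prop :=
  exists M : R, forall x, M < enorm x -> g x = 0.

Fixpoint CL (k : nat) (g : pt -> R) : Prop :=
  continuous g /\
  match k with
  | 0 => True
  | k'.+1 => forall i : 'I_n,
      (forall x, derivable g x (delta_mx ord0 i)) /\
      CL k' (fun x => 'D_(delta_mx ord0 i) g x)
  end.

(* wavelet indices: (l, j, k) ; l = 0 stands for phi(. - k) (j = 0),
   1 <= l <= 2^n - 1 for 2^{jn/2} psi_l(2^j . - k) ;  I_omega = 2^-j (k + [0,1)^n) *)
Definition windex := (nat * nat * 'rV[int]_n)%type.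
Definition Omega : set windex :=
  [set w | (w.1.1 = 0%N /\ w.1.2 = 0%N) \/ (1 <= w.1.1 <= 2 ^ n - 1)%N].

Definition intv (k : 'rV[int]_n) : pt := map_mx (fun z : int => z%:~R) k.

Definition wav (phi : pt -> R) (psi : nat -> pt -> R) (w : windex) : pt -> R :=
  let: (l, j, k) := w in
  if l == 0%N then fun x => phi (x - intv k)
  else fun x => 2 `^ ((j * n)%:R / 2) * psi l ((2 ^+ j) *: x - intv k).

Definition wcoef phi psi (g : pt -> R) (w : windex) : R :=
  intRn (fun x => g x * wav phi psi w x).

Definition daubechies (L : nat) (phi : pt -> R) (psi : nat -> pt -> R) : Prop :=
  [/\ CL L phi /\ compact_support phi,
      (forall l, (1 <= l <= 2 ^ n - 1)%N -> CL L (psi l) /\ compact_support (psi l)),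
      (forall l, (1 <= l <= 2 ^ n - 1)%N -> forall a : 'I_n -> nat,
          (\sum_(i < n) a i <= L)%N ->
          intRn (fun x => (\prod_(i < n) x ord0 i ^+ a i) * psi l x) = 0),
      (forall w w', Omega w -> Omega w' ->
          intRn (fun x => wav phi psi w x * wav phi psi w' x) =
          (if w == w' then 1 else 0))
    & (* completeness in L^2 (Parseval on the dense class C_c) *)
      (forall g : pt -> R, continuous g -> compact_support g ->
          (\esum_(w in Omega) ((wcoef phi psi g w) ^+ 2)%:E)%E =
          (intRn (fun x => g x ^+ 2))%:E)].

Definition cube (i : nat) (k : 'rV[int]_n) : set pt :=
  [set x | forall c : 'I_n, (k ord0 c)%:~R <= 2 ^+ i * x ord0 c < (k ord0 c)%:~R + 1].
Definition Tbox (i : nat) (k : 'rV[int]_n) : set (pt * R) :=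
  [set X | cube i k X.1 /\ 2 ^- i / 2 < X.2 <= 2 ^- i].

Definition W0 phi psi (i : nat) (s : R) (f : pt -> R) (eps : R) : set 'rV[int]_n :=
  [set k | exists l : nat, Omega (l, i, k) /\
     `|wcoef phi psi f (l, i, k)| > eps * (2 ^- (i * n)) `^ (s / n%:R + 2^-1)].
Definition T0 phi psi (i : int) (s : R) (f : pt -> R) (eps : R) : set (pt * R) :=
  match i with
  | Posz i' => [set X | exists2 k, W0 phi psi i' s f eps k & Tbox i' k X]
  | Negz _ => set0
  end.

(* hyperbolic metric on the upper half space, arccosh t = ln (t + sqrt(t^2-1)) *)
Definition arccosh (t : R) : R := ln (t + Num.sqrt (t ^+ 2 - 1)).
Definition hrho (X Y : pt * R) : R :=
  arccosh (1 + ((enorm (X.1 - Y.1)) ^+ 2 + (X.2 - Y.2) ^+ 2) / (2 * X.2 * Y.2)).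
Definition hnbhd (A : set (pt * R)) (Rr : R) : set (pt * R) :=
  [set X | 0 < X.2 /\ exists2 Y, A Y & hrho X Y < Rr].

End Defs.

(* Main.v *)
(** Write [f] as its wavelet series.  If [f] is in Lambda_s, a coefficient at scale
    2^-i, divided by the L^2 normalisation 2^(-in/2), is O(2^(-is)), whereas
    Delta_h^r of a wavelet of scale 2^-i is, relative to the size 2^(in/2) of the
    wavelet, O(min(1, (2^i |h|)^r')) with r' = min(r, L) > s.  Hence, for
    |h| ~ 2^-j, the total contribution of scale i to Delta_h^r f(x) is
    O(2^(-js) t^|i-j|) for some t < 1: the scales with |i-j| > m are negligible for
    m large, and if every coefficient at the remaining scales whose wavelet meets
    the points x + (p - r/2) h is below c eps 2^(-i(s + n/2)), then
    |Delta_h^r f(x)| < eps |h|^s.  The cubes of these wavelets are at bounded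
    hyperbolic distance from (x, |h|).

    The decay of the coefficients is obtained without polynomial approximation of
    [f].  Let A_t be the average of the (k-th order corrected) translates of [f] at
    scale 2^t against a fixed bump, so that f - A_t f is a mean of k-th differences.
    Telescoping A_t A_t f over t reduces the pairing of [f] with a wavelet to
    pairings of averages A_t g with g small, and there the average can be moved onto
    the wavelet, whose vanishing moments meet the Taylor expansion of the bump.  All
    averages are finite sums over a grid, so translation invariance and Riemann sums
    replace Fubini's theorem. *)

Require Import Defs.
From HB Require Import structures.
From mathcomp Require Import all_boot all_order all_algebra.
From mathcomp Require Import all_classical all_reals all_analysis.
From mathcomp Require finmap.
From mathcomp Require Import ring lra.
Import Order.TTheory GRing.Theory Num.Theory.
Import numFieldNormedType.Exports.
Local Open Scope classical_set_scope.
Local Open Scope ring_scope.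
Set Implicit Arguments. Unset Strict Implicit. Unset Printing Implicit Defensive.

(** * Integration on the line *)

Section Integral1.
Context {R : realType}.
Local Notation mu := (@lebesgue_measure R).
Implicit Types (K M a b c e h : R) (f g : R -> R).

(** Since f is only bounded, it need not be square integrable, while completeness is available for
    compactly supported continuous functions alone; pointwise bounds are therefore tested against
    such functions. The averages are squared before telescoping because A_t A_t - A_(t+1) A_(t+1)
    factors as (A_t + A_(t+1)) (A_t - A_(t+1)): the right factor is small by the difference bounds,
    and the left one is still an average that can be moved onto the wavelet. The factorisation needs
    commuting operators, so one grid serves all scales of a telescope. The bump is the truncated
    power max(0, 1 - |u|^2)^p with p = L, expanded by the binomial theorem without derivatives; its
    gain 2^(-tL) beats the growth 2^(ts) of the differences because s < L. The ratio of the overview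
    is max(2^s / 2^r', 2^-s), and its square root q serves twice: one factor q^|i-j| makes the sum
    over scales converge, the other gives q^m at the far scales. Half of the eps budget fixes c,
    which depends only on n, s, r and the wavelets; the other half fixes m through the decay
    constant of the coefficients of f, and R follows from m. *)

Definition cc1 (K : R) (g : R -> R) :=
  continuous g /\ forall t, K < `|t| -> g t = 0.

Definition int1 (g : R -> R) : R := Rintegral mu setT g.

Lemma cc1_within K g a b : cc1 K g -> {within `[a, b], continuous g}.
Proof. by move=> [cg _]; apply: continuous_subspaceT. Qed.

Lemma cc1_integrable_itv K g a b :
  cc1 K g -> mu.-integrable `[a, b] (EFin \o g).
Proof.
move=> /cc1_within cg; apply: continuous_compact_integrable.
  exact: segment_compact.
exact: cg.
Qed.

Lemma cc1_patch K g a b :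
  a <= - K -> K <= b -> cc1 K g -> g \_ `[a, b] = g.
Proof.
move=> aK Kb [_ g0]; apply/funext => t; rewrite patchE.
case: ifPn => // /negP tab; rewrite g0// ltNge; apply/negP => tK.
apply: tab; rewrite inE/= in_itv/=.
by move: tK; rewrite ler_norml => /andP[? ?]; apply/andP; split; lra.
Qed.

Lemma int1E K g a b : a <= - K -> K <= b -> cc1 K g ->
  int1 g = \int[mu]_(t in `[a, b]) g t.
Proof. by move=> aK Kb cg; rewrite Rintegral_mkcond (cc1_patch aK Kb cg). Qed.

Lemma cc1_integrable K g : cc1 K g -> mu.-integrable setT (EFin \o g).
Proof.
move=> cg; have := @cc1_integrable_itv K g (- K) K cg.
rewrite integrable_mkcond//.
by rewrite restrict_EFin (cc1_patch (lexx (- K)) (lexx K) cg).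
Qed.

Lemma int1D K f g : cc1 K f -> cc1 K g ->
  int1 (fun t => f t + g t) = int1 f + int1 g.
Proof.
by move=> cf cg; rewrite /int1 RintegralD//; apply: cc1_integrable; eauto.
Qed.

Lemma int1Z K c f : cc1 K f -> int1 (fun t => c * f t) = c * int1 f.
Proof. by move=> cf; rewrite /int1 RintegralZl//; apply: cc1_integrable; eauto. Qed.

Lemma int1_le K f g : cc1 K f -> cc1 K g -> (forall t, f t <= g t) ->
  int1 f <= int1 g.
Proof.
move=> cf cg fg; rewrite /int1; apply: le_Rintegral => //;
  by apply: cc1_integrable; eauto.
Qed.

Lemma Rintegral_itv_cst (a b c : R) : a <= b ->
  \int[mu]_(t in `[a, b]) (cst c t) = (b - a) * c.
Proof.
move=> ab; rewrite Rintegral_cst//= lebesgue_measure_itv/= lte_fin.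
case: ltgtP ab => // [ab _|-> _].
  by rewrite -EFinD/= mulrC.
by rewrite subrr mulr0 mul0r.
Qed.

Lemma integrable_itv_cst (a b c : R) :
  mu.-integrable `[a, b] (EFin \o cst c).
Proof.
apply: continuous_compact_integrable; first exact: segment_compact.
by apply: continuous_subspaceT => ?; apply: cvg_cst.
Qed.

Lemma Rintegral_itv_near K g a b c e : a <= b -> cc1 K g ->
  (forall t, a <= t <= b -> `|g t - c| <= e) ->
  `|\int[mu]_(t in `[a, b]) g t - (b - a) * c| <= (b - a) * e.
Proof.
move=> ab cg ge; rewrite -(Rintegral_itv_cst c ab).
have ig := @cc1_integrable_itv K g a b cg.
have [ic ie] := (integrable_itv_cst a b c, integrable_itv_cst a b e).
have iB : mu.-integrable `[a, b] (EFin \o (fun t => g t - cst c t)).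
  have H := integrableB _ ig ic.
  by apply: H; exact: measurable_itv.
rewrite -RintegralB//; apply: le_trans (le_normr_Rintegral _ iB) _ => //.
rewrite -(Rintegral_itv_cst e ab); apply: le_Rintegral => //=.
  exact: (integrable_abse iB).
Qed.

Lemma int1_norm_le K g e : 0 <= K -> cc1 K g -> (forall t, `|g t| <= e) ->
  `|int1 g| <= 2 * K * e.
Proof.
move=> K0 cg ge; rewrite (int1E (lexx _) (lexx _) cg).
have := @Rintegral_itv_near K g (- K) K 0 e _ cg.
rewrite mulr0 subr0 opprK -mulr2n mulr_natl; apply; first by lra.
by move=> t _; rewrite subr0.
Qed.

Lemma Rintegral_itv_cat K g a b c : a <= b -> b <= c -> cc1 K g ->
  \int[mu]_(t in `[a, c]) g t =
  \int[mu]_(t in `[a, b]) g t + \int[mu]_(t in `[b, c]) g t.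
Proof.
move=> ab bc cg.
have := @Rintegral_itvB R g (BLeft a) (BRight c) b (cc1_integrable_itv a c cg).
rewrite !bnd_simp => /(_ ab bc) /eqP; rewrite subr_eq addrC => /eqP ->.
congr (_ + _); apply: Rintegral_itv_obnd_cbnd.
apply: integrableS (cc1_integrable_itv b c cg) => //.
exact: subset_itv_oc_cc.
Qed.

(** Cells are added one at a time; on each, g stays within e of its value at the left endpoint. *)
Lemma itv_riemann K g a h e (N : nat) : 0 <= h -> cc1 K g ->
  (forall t u, `|t - u| <= h -> `|g t - g u| <= e) ->
  `|\int[mu]_(t in `[a, a + h *+ N]) g t - \sum_(q < N) h * g (a + h *+ q)|
    <= (h *+ N) * e.
Proof.
move=> h0 cg ge; elim: N => [|N IH].
  by rewrite mulr0n addr0 set_itv1 Rintegral_set1 big_ord0 subr0 normr0 mul0r.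
rewrite big_ord_recr/= (@Rintegral_itv_cat K g a (a + h *+ N))//; last 2 first.
- by rewrite lerDl mulrn_wge0.
- by rewrite mulrSr addrA lerDl.
rewrite opprD addrACA; apply: le_trans (ler_normD _ _) _.
rewrite [in X in _ <= X]mulrSr mulrDl; apply: lerD => //.
have := @Rintegral_itv_near K g (a + h *+ N) (a + h *+ N.+1) (g (a + h *+ N)) e.
have -> : a + h *+ N.+1 - (a + h *+ N) = h by rewrite mulrSr; lra.
apply => //; first by rewrite mulrSr; lra.
rewrite mulrSr => t tN; apply: ge; rewrite ler_norml; apply/andP; split; lra.
Qed.

Lemma int1_riemann M g h e (Q : nat) : 0 <= h -> h *+ Q = M -> cc1 M g ->
  (forall t u, `|t - u| <= h -> `|g t - g u| <= e) ->
  `|int1 g - \sum_(q < Q.*2) h * g (h *+ q - M)| <= 2 * M * e.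
Proof.
move=> h0 hQ cg ge.
have -> : int1 g = \int[mu]_(t in `[- M, - M + h *+ Q.*2]) g t.
  apply: int1E cg => //; rewrite -addnn mulrnDr hQ; lra.
have := itv_riemann (- M) Q.*2 h0 cg ge.
have -> : h *+ Q.*2 = 2 * M by rewrite -addnn mulrnDr hQ; lra.
by under eq_bigr do rewrite addrC.
Qed.

Lemma continuous_affine (a b : R) : continuous (fun t : R => a * t + b).
Proof.
by move=> t; apply: cvgD; [apply: cvgM; [apply: cvg_cst|]|apply: cvg_cst].
Qed.

Lemma is_derive_affine (a b x : R) : is_derive x 1 (fun t : R => a * t + b) a.
Proof. by apply: is_derive_eq; rewrite ?scaler0 ?addr0 ?mulr1 /GRing.scale/= ?mulr1. Qed.

Lemma cc1_affine K g (a b : R) : a != 0 -> cc1 K g ->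
  cc1 ((K + `|b|) / `|a|) (fun t => g (a * t + b)).
Proof.
move=> a0 [cg g0]; split.
  by move=> t; apply: continuous_comp; [exact: continuous_affine|exact: cg].
move=> t; rewrite ltr_pdivrMr ?normr_gt0// => h; apply: g0.
have : `|a * t| <= `|a * t + b| + `|b|.
  by have := ler_normB (a * t + b) b; rewrite addrK.
by rewrite normrM; lra.
Qed.

Lemma int1_affine_pos K g (a b : R) : 0 < a -> cc1 K g ->
  int1 (fun t => a * g (a * t + b)) = int1 g.
Proof.
move=> a0 cg; pose K' := `|K| + `|b|.
have KK : K <= `|K| by exact: ler_norm.
have Kb := ler_norm b.
have Nb : - b <= `|b| by rewrite -normrN ler_norm.
have [Ka Kb0] : 0 <= `|K| /\ 0 <= `|b| by [].
(* Wide enough that [-L, L] holds the support of the substituted integrand and its image under [F]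
   holds [-K, K]. *)
pose L := K' / a.
have aL : a * L = K' by rewrite /L mulrC divfK ?gt_eqF.
pose F : R -> R := fun t => a * t + b.
have dF : derive1 F = cst a.
  by apply/funext => t; rewrite derive1E; apply: (@derive_val _ _ _ _ _ _ _ (is_derive_affine a b t)).
rewrite [RHS](@int1E K g (F (- L)) (F L))//; last 2 first.
- by rewrite /F mulrN aL /K'; lra.
- by rewrite /F aL /K'; lra.
rewrite (@int1E ((K + `|b|) / `|a|) _ (- L) L); last 3 first.
- by rewrite (gtr0_norm a0) lerN2 /L ler_pM2r ?invr_gt0//; rewrite /K'; lra.
- by rewrite (gtr0_norm a0) /L ler_pM2r ?invr_gt0//; rewrite /K'; lra.
- have := @cc1_affine K g a b (lt0r_neq0 a0) cg => -[c1 c2]; split.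
    by move=> t; apply: cvgM; [apply: cvg_cst|apply: c1].
  by move=> t /c2 ->; rewrite mulr0.
rewrite /Rintegral (@integration_by_substitution_increasing R F g (- L) L).
- congr fine; apply: eq_integral => t _; congr EFin.
  by rewrite dF !fctE/= mulrC.
- have : 0 <= L by rewrite divr_ge0 ?addr_ge0// ltW.
  by lra.
- by move=> x y _ _ xy; rewrite /F ltrD2r ltr_pM2l.
- by rewrite dF => ? _; exact: cvg_cst.
- by rewrite dF; exact: is_cvg_cst.
- by rewrite dF; exact: is_cvg_cst.
- split.
  + by move=> x _; apply: ex_derive; apply: is_derive_affine.
  + by apply: cvg_at_right_filter; apply: continuous_affine.
  + by apply: cvg_at_left_filter; apply: continuous_affine.
- exact: cc1_within cg.
Qed.

Lemma int1_opp K g : cc1 K g -> int1 (fun t => g (- t)) = int1 g.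
Proof.
move=> cg; pose L := `|K|.
have KK : K <= `|K| by exact: ler_norm.
have cg' : cc1 K (fun t => g (- t)).
  split; last by move=> t tK; apply: cg.2; rewrite normrN.
  by move=> t; apply: continuous_comp; [exact: opp_continuous|exact: cg.1].
rewrite [RHS](@int1E K g (- L) (- - L))//; last 2 first.
- by rewrite lerN2.
- by rewrite opprK.
rewrite (@int1E K _ (- L) L)//; last by rewrite lerN2.
rewrite /Rintegral (@integration_by_substitution_oppr R g (- L) L)//.
- have : 0 <= L by exact: normr_ge0. by lra.
- exact: cc1_within cg.
Qed.

Lemma int1_affine K g (a b : R) : a != 0 -> cc1 K g ->
  int1 (fun t => g (a * t + b)) = `|a|^-1 * int1 g.
Proof.
move=> a0 cg.
have pos c d : 0 < c -> int1 (fun t => g (c * t + d)) = c^-1 * int1 g.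
  move=> c0; rewrite -(@int1_affine_pos K g c d c0 cg).
  rewrite (@int1Z ((K + `|d|) / `|c|)) ?mulKf ?gt_eqF//.
  by apply: cc1_affine; rewrite ?gt_eqF.
move: a0; rewrite neq_lt => /orP[a0|a0]; last by rewrite gtr0_norm// pos.
rewrite ltr0_norm//.
rewrite -(pos (- a) b) ?oppr_gt0//.
rewrite -[RHS](@int1_opp ((K + `|b|) / `|- a|)).
  by apply: congr1; apply/funext => t; rewrite mulrNN.
by apply: cc1_affine; rewrite ?oppr_eq0 ?lt_eqF.
Qed.

End Integral1.

(** * The sup norm and continuity on row vectors *)

Section SupNorm.
Context {R : realType} {n : nat}.
Local Notation pt := 'rV[R]_n.

Lemma rv_norm_coord (x : pt) (i : 'I_n) : `|x ord0 i| <= `|x|.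
Proof.
rewrite [leRHS]/Num.Def.normr /= mx_normrE; apply/bigmax_geP; right => /=.
by exists (ord0, i).
Qed.

Lemma rv_norm_le (x : pt) (e : R) :
  0 <= e -> (forall i, `|x ord0 i| <= e) -> `|x| <= e.
Proof.
move=> e0 xe; rewrite [leLHS]/Num.Def.normr /= mx_normrE; apply/bigmax_leP; split => //.
by move=> [i j] _ /=; rewrite ord1.
Qed.

Lemma rv_norm_gt (x : pt) (e : R) :
  0 <= e -> e < `|x| -> exists i, e < `|x ord0 i|.
Proof.
move=> e0 ex; apply/not_existsP => H.
suff : `|x| <= e by rewrite leNgt ex.
by apply: rv_norm_le => // i; rewrite leNgt; apply/negP; exact: H.
Qed.

Lemma enorm_ge0 (x : pt) : 0 <= enorm x.
Proof. exact: sqrtr_ge0. Qed.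

Lemma rv_norm_le_enorm (x : pt) : `|x| <= enorm x.
Proof.
apply: rv_norm_le (enorm_ge0 x) _ => i; rewrite -sqrtr_sqr ler_sqrt ?sqr_ge0//.
  by rewrite (bigD1 i)//= lerDl sumr_ge0// => *; exact: sqr_ge0.
by apply: sumr_ge0 => *; exact: sqr_ge0.
Qed.

Lemma enorm_sqr_le (x : pt) : enorm x ^+ 2 <= n%:R * `|x| ^+ 2.
Proof.
rewrite sqr_sqrtr; last by apply: sumr_ge0 => *; exact: sqr_ge0.
rewrite -[n in n%:R]card_ord -sum1_card natr_sum mulr_suml; apply: ler_sum => i _.
by rewrite mul1r -real_normK ?num_real// ler_sqr ?nnegrE// rv_norm_coord.
Qed.

Lemma enorm_le (x : pt) : enorm x <= n%:R * `|x|.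
Proof.
have n0 : 0 <= n%:R * `|x| :> R by rewrite mulr_ge0.
rewrite -ler_sqr ?nnegrE ?enorm_ge0//; apply: le_trans (enorm_sqr_le x) _.
rewrite exprMn ler_wpM2r ?sqr_ge0// expr2.
by case: n => [|k]; rewrite ?mulr0// ler_peMr// ler1n.
Qed.

Lemma enorm_eq0 (x : pt) : enorm x = 0 -> x = 0.
Proof.
by move=> x0; apply/eqP; rewrite -normr_le0 -x0 rv_norm_le_enorm.
Qed.

Lemma setcE (x : pt) k t (i : 'I_n) :
  setc x k t ord0 i = if (i : nat) == k then t else x ord0 i.
Proof. by rewrite mxE. Qed.

Lemma setcB_norm (x y : pt) k t : `|setc x k t - setc y k t| <= `|x - y|.
Proof.
apply: rv_norm_le => // i; rewrite !mxE; case: ifP => _.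
  by rewrite subrr normr0.
by have := rv_norm_coord (x - y) i; rewrite !mxE.
Qed.

Lemma setcB_norm1 (x : pt) k t u : `|setc x k t - setc x k u| <= `|t - u|.
Proof.
by apply: rv_norm_le => // i; rewrite !mxE; case: ifP => _ //; rewrite subrr normr0.
Qed.

Lemma rv_nbhs (x : pt) (A : set pt) (d : R) :
  0 < d -> (forall y, `|x - y| < d -> A y) -> nbhs x A.
Proof.
by move=> d0 H; apply: (proj2 (nbhs_normP x A)); exists d.
Qed.

Lemma rv_continuousP (G : pt -> R) (x : pt) :
  {for x, continuous G} <->
  forall e, 0 < e -> exists2 d, 0 < d & forall y, `|x - y| < d -> `|G x - G y| < e.
Proof.
split=> [/cvgrPdist_lt H e e0|H].
  by have /nbhs_normP[d d0 dH] := H e e0; exists d.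
apply/(@cvgrPdist_lt _ _ _ (nbhs x) (nbhs_filter x)) => e /H[d d0 dH].
exact: rv_nbhs d0 dH.
Qed.

End SupNorm.

(** * Continuous functions of a row vector *)

Section Continuity.
Context {R : realType} {n : nat}.
Local Notation pt := 'rV[R]_n.
Implicit Types (G H : pt -> R) (x y : pt).

Lemma rv_cst (c : R) : continuous (fun _ : pt => c).
Proof.
by move=> x; apply/rv_continuousP => e e0; exists 1 => // y _; rewrite subrr normr0.
Qed.

Lemma rv_cD G H : continuous G -> continuous H -> continuous (fun x => G x + H x).
Proof. by move=> cG cH x; exact: (@continuousD _ _ _ G H x (cG x) (cH x)). Qed.

Lemma rv_cM G H : continuous G -> continuous H -> continuous (fun x => G x * H x).
Proof. by move=> cG cH x; exact: (@continuousM _ _ G H x (cG x) (cH x)). Qed.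

Lemma rv_cN G : continuous G -> continuous (fun x => - G x).
Proof. by move=> cG x; exact: (@continuousN _ _ _ G x (cG x)). Qed.

Lemma rv_cZ (c : R) G : continuous G -> continuous (fun x => c * G x).
Proof. by move=> cG; apply: rv_cM => //; exact: rv_cst. Qed.

Lemma rv_cX G k : continuous G -> continuous (fun x => G x ^+ k).
Proof.
move=> cG; elim: k => [|k IH]; first exact: rv_cst.
by under eq_fun do rewrite exprS; exact: rv_cM.
Qed.

Lemma rv_csum (I : Type) (r : seq I) (F : I -> pt -> R) :
  (forall i, continuous (F i)) -> continuous (fun x => \sum_(i <- r) F i x).
Proof.
move=> cF; elim: r => [|i r IH].
  by under eq_fun do rewrite big_nil; exact: rv_cst.
by under eq_fun do rewrite big_cons; exact: rv_cD.
Qed.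

Lemma rv_ccoord (i : 'I_n) : continuous (fun x : pt => x ord0 i).
Proof.
move=> x; apply/rv_continuousP => e e0; exists e => // y; apply: le_lt_trans.
by have := rv_norm_coord (x - y) i; rewrite !mxE.
Qed.

Lemma rv_caff G (a : R) (b : pt) :
  continuous G -> continuous (fun x => G (a *: x + b)).
Proof.
move=> cG x; apply/rv_continuousP => e e0.
have /rv_continuousP/(_ _ e0)[d d0 dH] := cG (a *: x + b).
exists (d / (`|a| + 1)); first by rewrite divr_gt0// ltr_wpDl.
move=> y; rewrite ltr_pdivlMr ?ltr_wpDl// => xy; apply: dH.
rewrite opprD addrACA subrr addr0 -scalerBr normrZ mulrC.
by apply: le_lt_trans xy; rewrite ler_wpM2l// lerDl.
Qed.

Lemma rv_ctrans G (b : pt) : continuous G -> continuous (fun x => G (x + b)).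
Proof. by move=> /(@rv_caff G 1 b); under eq_fun do rewrite scale1r. Qed.

End Continuity.

(** * Compact support and uniform continuity *)

Section CompactSupport.
Context {R : realType} {n : nat}.
Local Notation pt := 'rV[R]_n.
Implicit Type K : R.

(** The radius is measured in the sup norm, so that every coordinate slice is supported in [-K, K]
    and one radius serves all stages of the iterated integral. *)
Definition ccn (K : R) (G : pt -> R) :=
  continuous G /\ forall x, K < `|x| -> G x = 0.

Lemma ccnW K K' (G : pt -> R) : K <= K' -> ccn K G -> ccn K' G.
Proof. by move=> KK [cG G0]; split => // x /(le_lt_trans KK); exact: G0. Qed.

Lemma ball_compact (K : R) : compact [set x : pt | `|x| <= K].
Proof.
apply: bounded_closed_compact.
  by exists K; split; [exact: num_real|move=> M KM x /= xK; lra].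
rewrite [X in closed X](_ : _ = Num.Def.normr @^-1` [set t : R | t <= K])//.
by apply: preimage_closed; [move=> x _; exact: norm_continuous|exact: closed_le].
Qed.

Lemma continuous_ball_bounded (G : pt -> R) K : continuous G ->
  exists2 B, 0 <= B & forall x, `|x| <= K -> `|G x| <= B.
Proof.
move=> cG.
have := @continuous_compact _ _ G _ (continuous_subspaceT cG) (@ball_compact K).
move=> /compact_bounded[M [Mr H]]; exists (`|M| + 1) => // x xK.
apply: H; last by exists x.
by have := ler_norm M; lra.
Qed.

Lemma ccn_bounded K (G : pt -> R) : ccn K G ->
  exists2 B, 0 <= B & forall x, `|G x| <= B.
Proof.
move=> [cG G0]; have [B B0 H] := @continuous_ball_bounded G K cG.
exists B => // x; have [xK|xK] := leP `|x| K; first exact: H.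
by rewrite G0// normr0.
Qed.

Definition unifc (G : pt -> R) := forall e, 0 < e -> exists2 d, 0 < d &
  forall x y, `|x - y| <= d -> `|G x - G y| <= e.

Lemma ccn_unifc K (G : pt -> R) : ccn K G -> unifc G.
Proof.
move=> [cG G0] e e0.
(* The margin 1 exceeds the modulus d found below: if x is outside this larger ball, both x and y
   are outside the support. *)
have cB : near_covering [set x : pt | `|x| <= K + 1].
  by apply/compact_near_coveringP; exact: ball_compact.
pose P (d : R) (x : pt) := forall y, `|x - y| <= d -> `|G x - G y| <= e.
have /cB : forall x, [set x : pt | `|x| <= K + 1] x ->
    \forall x' \near x & d \near (0:R)^'+, P d x'.
  move=> x _; have e2 : 0 < e / 2 by rewrite divr_gt0.
  have /rv_continuousP/(_ _ e2)[d d0 dH] := cG x.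
  exists ([set z : pt | `|x - z| < d / 2], [set t : R | t < d / 2]) => /=.
    split.
      have d2 : 0 < d / 2 by rewrite divr_gt0.
      by have := rv_nbhs d2 (fun y (xy : `|x - y| < d / 2) => xy).
    by apply: nbhs_right_lt; rewrite divr_gt0.
  move=> [z t] /= [xz td] y zy.
  have h1 : `|G x - G z| < e / 2 by apply: dH; lra.
  have h2 : `|G x - G y| < e / 2.
    apply: dH; rewrite -(subrKA z); apply: le_lt_trans (ler_normD _ _) _; lra.
  rewrite -(subrKA (G x)); apply: le_trans (ler_normD _ _) _.
  rewrite (distrC (G z)); lra.
move=> H.
have [d [Hd d0 d1]] : exists d, [/\ ([set x : pt | `|x| <= K + 1] `<=` P d), 0 < d & d < 1].
  apply: (@filter_ex _ (0:R)^'+).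
  near=> d; split; near: d; [exact: H|exact: nbhs_right_gt|exact: nbhs_right_lt].
exists d => // x y xy.
have [xK|xK] := leP `|x| (K + 1); first exact: Hd.
rewrite !G0 ?subrr ?normr0 ?ltW//; last by lra.
have := ler_normD (x - y) y; rewrite subrK; lra.
Unshelve. all: by end_near. Qed.

End CompactSupport.

(** * Iterated integrals *)

Section IteratedIntegral.
Context {R : realType} {n : nat}.
Local Notation pt := 'rV[R]_n.
Implicit Types (K : R) (G H : pt -> R) (x y : pt).

(** Coordinates of index at least k are still parameters at stage k, so a large one keeps every
    point of integration outside the support. *)
Lemma iterint_eq0 K G k x (c : 'I_n) : ccn K G -> (k <= c)%N ->
  K < `|x ord0 c| -> iterint k G x = 0.
Proof.
move=> [_ G0]; elim: k x => [|k IH] x kc Kx /=.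
  by apply: G0; apply: lt_le_trans Kx (rv_norm_coord _ _).
rewrite (_ : (fun t => _) = cst 0); last first.
  by apply/funext => t; rewrite IH ?(ltnW kc)// setcE gtn_eqF.
by rewrite /Rintegral integral0_eq.
Qed.

(** The two claims need a joint induction: the modulus at stage k+1 integrates slices of stage k,
    which must be known to be continuous, and this continuity is read off the modulus. Each
    integration over [-K, K] costs a factor 2K. *)
Lemma iterint_modulus K G k : 0 <= K -> ccn K G -> (k <= n)%N ->
  (forall d e, (forall x y, `|x - y| <= d -> `|G x - G y| <= e) ->
    forall x y, `|x - y| <= d ->
      `|iterint k G x - iterint k G y| <= (2 * K) ^+ k * e) /\
  (forall x, (k < n)%N -> cc1 K (fun t => iterint k G (setc x k t))).
Proof.
move=> K0 cG; elim: k => [|k IH] kn.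
  have cc x : (0 < n)%N -> cc1 K (fun t => iterint 0 G (setc x 0 t)).
    move=> n0; split.
      move=> t; apply: (@continuous_comp _ _ _ (setc x 0) G); last exact: cG.1.
      apply/cvgrPdist_lt => e e0; near=> u.
      apply: le_lt_trans (setcB_norm1 _ _ _ _) _.
      near: u; apply/nbhs_normP; exists e => //= u; exact.
    move=> t Kt; apply: cG.2; apply: lt_le_trans Kt _.
    by have := rv_norm_coord (setc x 0 t) (Ordinal n0); rewrite setcE eqxx.
  by split=> // d e H x y xy; rewrite expr0 mul1r; exact: H.
have [IH1 IH2] := IH (ltnW kn).
have modk d e : (forall x y, `|x - y| <= d -> `|G x - G y| <= e) ->
    forall x y, `|x - y| <= d ->
      `|iterint k.+1 G x - iterint k.+1 G y| <= (2 * K) ^+ k.+1 * e.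
  move=> H x y xy /=.
  have [cx cy] := (IH2 x kn, IH2 y kn).
  rewrite -!/(int1 _) -[X in _ - X]mul1r -mulNr -(int1Z _ cy) -(int1D cx); last first.
    split; first by move=> t; apply: cvgM; [exact: cvg_cst|exact: cy.1].
    by move=> t /cy.2 ->; rewrite mulr0.
  rewrite exprS -mulrA; apply: int1_norm_le => //.
    split; last by move=> t Kt; rewrite cx.2// cy.2// mulr0 addr0.
    move=> t; apply: cvgD; first exact: cx.1.
    by apply: cvgM; [exact: cvg_cst|exact: cy.1].
  move=> t; rewrite mulN1r; apply: IH1 H _ _ _.
  exact: le_trans (setcB_norm _ _ _ _) xy.
split=> // x kn1; split; last first.
  move=> t Kt; apply: (@iterint_eq0 K _ _ _ (Ordinal kn1)) => //.
  by rewrite setcE eqxx.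
move=> t; apply/cvgrPdist_le => e e0.
have C0 : 0 < (2 * K) ^+ k.+1 + 1 by rewrite ltr_wpDl// exprn_ge0 ?mulr_ge0.
have [d d0 dH] := ccn_unifc cG (divr_gt0 e0 C0).
apply/nbhs_normP; exists d => //= u tu.
apply: le_trans (modk _ _ dH _ _ _) _.
  by apply: le_trans (setcB_norm1 _ _ _ _) (ltW tu).
by rewrite mulrCA ler_piMr ?(ltW e0)// ler_pdivrMr// mul1r lerDl.
Unshelve. all: by end_near. Qed.

Lemma iterint_cc1 K G k x : 0 <= K -> ccn K G -> (k < n)%N ->
  cc1 K (fun t => iterint k G (setc x k t)).
Proof. by move=> K0 cG kn; exact: (iterint_modulus K0 cG (ltnW kn)).2. Qed.

Lemma ccnD K G H : ccn K G -> ccn K H -> ccn K (fun x => G x + H x).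
Proof.
move=> [cG G0] [cH H0]; split; last by move=> x Kx; rewrite G0// H0// addr0.
exact: rv_cD.
Qed.

Lemma ccnMl K G H : ccn K G -> continuous H -> ccn K (fun x => H x * G x).
Proof.
move=> [cG G0] cH; split; last by move=> x Kx; rewrite G0// mulr0.
exact: rv_cM.
Qed.

Lemma ccnMr K G H : ccn K G -> continuous H -> ccn K (fun x => G x * H x).
Proof.
move=> cG cH; have := ccnMl cG cH.
by congr (ccn K _); apply/funext => x; rewrite mulrC.
Qed.

Lemma ccnZ K c G : ccn K G -> ccn K (fun x => c * G x).
Proof. by move=> cG; apply: ccnMl => //; exact: rv_cst. Qed.

Lemma ccn0 K : ccn K (fun _ : pt => 0 : R).
Proof. by split=> //; exact: rv_cst. Qed.

Lemma ccn_norm K G : ccn K G -> ccn K (fun x => `|G x|).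
Proof.
move=> [cG G0]; split; last by move=> x Kx; rewrite G0// normr0.
by move=> x; apply: (@continuous_comp _ _ _ G); [exact: cG|exact: norm_continuous].
Qed.

Lemma ccn_sum (I : Type) (r : seq I) (F : I -> pt -> R) K :
  (forall i, ccn K (F i)) -> ccn K (fun x => \sum_(i <- r) F i x).
Proof.
move=> cF; elim: r => [|i r IH].
  by have := @ccn0 K; congr (ccn K _); apply/funext => x; rewrite big_nil.
have := ccnD (cF i) IH.
by congr (ccn K _); apply/funext => x; rewrite big_cons.
Qed.

Lemma iterintD K G H k x : 0 <= K -> ccn K G -> ccn K H -> (k <= n)%N ->
  iterint k (fun x => G x + H x) x = iterint k G x + iterint k H x.
Proof.
move=> K0 cG cH; elim: k x => // k IH x kn /=.
rewrite -!/(int1 _) -(@int1D _ K); [|exact: iterint_cc1..].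
by apply: congr1; apply/funext => t; rewrite IH ?(ltnW kn).
Qed.

Lemma iterintZ K c G k x : 0 <= K -> ccn K G -> (k <= n)%N ->
  iterint k (fun x => c * G x) x = c * iterint k G x.
Proof.
move=> K0 cG; elim: k x => // k IH x kn /=.
rewrite -!/(int1 _) -(@int1Z _ K); last exact: iterint_cc1.
by apply: congr1; apply/funext => t; rewrite IH ?(ltnW kn).
Qed.

Lemma iterint_le K G H k x : 0 <= K -> ccn K G -> ccn K H -> (k <= n)%N ->
  (forall x, G x <= H x) -> iterint k G x <= iterint k H x.
Proof.
move=> K0 cG cH + GH; elim: k x => // k IH x kn /=.
apply: (@int1_le _ K); [exact: iterint_cc1..|].
by move=> t; apply: IH; exact: ltnW.
Qed.

Lemma iterint_affine K G (a : R) (b : pt) k x : 0 <= K -> a != 0 ->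
  ccn K G -> (k <= n)%N ->
  iterint k (fun x => G (a *: x + b)) x = `|a| ^- k * iterint k G (a *: x + b).
Proof.
move=> K0 a0 cG; elim: k x => [|k IH] x kn /=; first by rewrite expr0 invr1 mul1r.
under [X in Rintegral _ _ X]funext => t do rewrite IH ?(ltnW kn)//.
have cc := @iterint_cc1 K G k (a *: x + b) K0 cG kn.
(* Setting coordinate k to t before the affine map amounts to setting it to a t + b_k afterwards, so
   each stage is a one-dimensional substitution. *)
have E t : iterint k G (a *: setc x k t + b) =
    iterint k G (setc (a *: x + b) k (a * t + b ord0 (Ordinal kn))).
  congr iterint; apply/rowP => i; rewrite !mxE; case: eqP => // ik.
  by congr (_ + b _ _); apply/val_inj.
under [X in Rintegral _ _ X]funext => t do rewrite E.
rewrite -!/(int1 _) (@int1Z _ ((K + `|b ord0 (Ordinal kn)|) / `|a|)); last first.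
  exact: (cc1_affine _ a0 cc).
by rewrite (int1_affine _ a0 cc) mulrA exprS invfM [_^-1 * _]mulrC.
Qed.

(** Coordinates of index below k are integrated out; this makes the base point 0 in [intRn]
    immaterial. *)
Lemma iterint_indep G k x y :
  (forall i : 'I_n, (k <= i)%N -> x ord0 i = y ord0 i) ->
  iterint k G x = iterint k G y.
Proof.
elim: k x y => [|k IH] x y xy /=; first by congr G; apply/rowP => i; exact: xy.
apply: congr1; apply/funext => t; apply: IH => i ki; rewrite !setcE.
by case: eqP => // /eqP ik; apply: xy; rewrite ltn_neqAle eq_sym ik.
Qed.

Lemma intRnD K G H : 0 <= K -> ccn K G -> ccn K H ->
  intRn (fun x => G x + H x) = intRn G + intRn H.
Proof. by move=> K0 cG cH; exact: iterintD K0 cG cH _. Qed.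

Lemma intRnZ K c G : 0 <= K -> ccn K G -> intRn (fun x => c * G x) = c * intRn G.
Proof. by move=> K0 cG; exact: iterintZ K0 cG _. Qed.

Lemma intRnB K G H : 0 <= K -> ccn K G -> ccn K H ->
  intRn (fun x => G x - H x) = intRn G - intRn H.
Proof.
move=> K0 cG cH; rewrite -mulN1r -(intRnZ _ K0 cH) -(intRnD K0 cG (ccnZ _ cH)).
by congr intRn; apply/funext => x; rewrite mulN1r.
Qed.

Lemma intRn0 : intRn (fun _ : pt => 0 : R) = 0 :> R.
Proof.
rewrite -[RHS](mul0r (intRn (fun _ : pt => 0 : R))) -(intRnZ 0 (lexx 0) (ccn0 0)).
by congr intRn; apply/funext => x; rewrite mul0r.
Qed.

Lemma intRn_sum (I : Type) (r : seq I) (F : I -> pt -> R) K : 0 <= K ->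
  (forall i, ccn K (F i)) ->
  intRn (fun x => \sum_(i <- r) F i x) = \sum_(i <- r) intRn (F i).
Proof.
move=> K0 cF; elim: r => [|i r IH].
  by rewrite big_nil -[RHS]intRn0; congr intRn; apply/funext => x; rewrite big_nil.
rewrite big_cons -IH -(intRnD K0 (cF i) (ccn_sum r cF)).
by congr intRn; apply/funext => x; rewrite big_cons.
Qed.

Lemma intRn_le K G H : 0 <= K -> ccn K G -> ccn K H ->
  (forall x, G x <= H x) -> intRn G <= intRn H.
Proof. by move=> K0 cG cH GH; exact: iterint_le K0 cG cH _ GH. Qed.

Lemma intRn_ge0 K G : 0 <= K -> ccn K G -> (forall x, 0 <= G x) -> 0 <= intRn G.
Proof. by move=> K0 cG G0; rewrite -intRn0; exact: intRn_le K0 (ccn0 K) cG G0. Qed.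

Lemma intRn_norm K G : 0 <= K -> ccn K G ->
  `|intRn G| <= intRn (fun x => `|G x|).
Proof.
move=> K0 cG; have cN := ccn_norm cG.
rewrite ler_norml -mulN1r -(intRnZ _ K0 cN); apply/andP; split.
  apply: (intRn_le K0 (ccnZ _ cN) cG) => x.
  by rewrite mulN1r lerNl -normrN ler_norm.
by apply: (intRn_le K0 cG cN) => x; exact: ler_norm.
Qed.

Lemma intRn_bound K G e : 0 <= K -> ccn K G -> (forall x, `|G x| <= e) ->
  `|intRn G| <= (2 * K) ^+ n * e.
Proof.
move=> K0 cG Ge.
suff H k x : (k <= n)%N -> `|iterint k G x| <= (2 * K) ^+ k * e by exact: H.
elim: k x => [|k IH] x kn; first by rewrite expr0 mul1r.
rewrite exprS -mulrA; apply: int1_norm_le => //; first exact: iterint_cc1.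
by move=> t; apply: IH; exact: ltnW.
Qed.

Lemma intRn_affine K G (a : R) (b : pt) : 0 <= K -> a != 0 -> ccn K G ->
  intRn (fun x => G (a *: x + b)) = `|a| ^- n * intRn G.
Proof.
move=> K0 a0 cG; rewrite /intRn (iterint_affine _ _ K0 a0 cG)//; congr (_ * _).
by apply: iterint_indep => i; rewrite leqNgt ltn_ord.
Qed.

Lemma ccn_affine K G (a : R) (b : pt) : a != 0 -> ccn K G ->
  ccn ((K + `|b|) / `|a|) (fun x => G (a *: x + b)).
Proof.
move=> a0 [cG G0]; split.
  exact: rv_caff.
move=> x; rewrite ltr_pdivrMr ?normr_gt0// => h; apply: G0.
have : `|a *: x| <= `|a *: x + b| + `|b|.
  by have := ler_normB (a *: x + b) b; rewrite addrK.
by rewrite normrZ; lra.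
Qed.

End IteratedIntegral.

(** * Parseval *)

Section Parseval.
Context {R : realType} {n : nat}.
Local Notation pt := 'rV[R]_n.
Implicit Types (K B : R) (g G : pt -> R) (x y : pt).

Lemma CL_continuous k g : CL k g -> continuous g.
Proof. by case: k => [|k] []. Qed.

Lemma compact_support_ccn g : continuous g -> compact_support g ->
  exists2 K, 0 <= K & ccn K g.
Proof.
move=> cg [M gM]; exists `|M| => //; split => // x Mx; apply: gM.
by apply: le_lt_trans (ler_norm M) _; apply: lt_le_trans Mx (rv_norm_le_enorm x).
Qed.

Lemma ccn_compact_support K g : 0 <= K -> ccn K g -> compact_support g.
Proof.
move=> K0 [_ g0]; exists (n%:R * K) => x h; apply: g0; rewrite ltNge; apply/negP => xK.
have := lt_le_trans h (enorm_le x).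
by rewrite ltNge ler_wpM2l.
Qed.

Variables (L : nat) (phi : pt -> R) (psi : nat -> pt -> R).
Hypothesis dau : daubechies L phi psi.

Lemma phi_ccn : exists2 K, 0 <= K & ccn K phi.
Proof.
by case: dau => -[/CL_continuous cphi sphi] _ _ _ _; exact: compact_support_ccn.
Qed.

Lemma psi_continuous l : (1 <= l <= 2 ^ n - 1)%N -> continuous (psi l).
Proof. by case: dau => _ H _ _ _ /H[/CL_continuous]. Qed.

Lemma psi_ccn l : (1 <= l <= 2 ^ n - 1)%N -> exists2 K, 0 <= K & ccn K (psi l).
Proof.
move=> ln; have := psi_continuous ln.
by case: dau => _ /(_ l ln)[_ spsi] _ _ _ cpsi; exact: compact_support_ccn.
Qed.

Lemma Omega_gt0 (w : windex n) : Omega w -> w.1.1 != 0%N -> (1 <= w.1.1 <= 2 ^ n - 1)%N.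
Proof. by move=> [[-> _]|]. Qed.

Lemma wav_continuous w : Omega w -> continuous (wav phi psi w).
Proof.
case: w => -[l j] k /Omega_gt0 /= lO; case: eqP lO => [_ _|_ /(_ isT) ln].
  by apply: rv_ctrans; case: dau => -[/CL_continuous].
by apply: rv_cZ; apply: rv_caff; exact: psi_continuous.
Qed.

Lemma wcoefD K g g' w : 0 <= K -> ccn K g -> ccn K g' -> Omega w ->
  wcoef phi psi (fun x => g x + g' x) w = wcoef phi psi g w + wcoef phi psi g' w.
Proof.
move=> K0 cg cg' /wav_continuous cw.
rewrite /wcoef -(intRnD K0 (ccnMr cg cw) (ccnMr cg' cw)).
by congr intRn; apply/funext => x; rewrite mulrDl.
Qed.

Lemma wcoefN K g w : 0 <= K -> ccn K g -> Omega w ->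
  wcoef phi psi (fun x => - g x) w = - wcoef phi psi g w.
Proof.
move=> K0 cg /wav_continuous cw.
rewrite /wcoef -mulN1r -(intRnZ _ K0 (ccnMr cg cw)).
by congr intRn; apply/funext => x; rewrite mulrA mulN1r.
Qed.

Lemma ccnN K g : ccn K g -> ccn K (fun x => - g x).
Proof.
move=> /(ccnZ (-1)); congr (ccn K _); apply/funext => x.
by rewrite mulN1r.
Qed.

Lemma esum_le_seq (T : choiceType) (D : set T) (a : T -> R) B :
  (forall s : seq T, uniq s -> (forall w, w \in s -> D w) ->
    \sum_(w <- s) a w <= B) ->
  (\esum_(w in D) (a w)%:E <= B%:E)%E.
Proof.
move=> H; apply: ub_ereal_sup => _ [A [fA AD] <-].
rewrite fsbig_finite//= sumEFin lee_fin; apply: H; first exact: finmap.fset_uniq.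
by move=> w; rewrite in_fset_set// inE; exact: AD.
Qed.

(** Polarisation: Parseval for g + g' and g - g', with (a + b)^2 <= (a - b)^2 + 4 |ab| termwise.
    Only sums of nonnegative terms occur, so a bound on the finite partial sums is enough. *)
Lemma parseval_le K g g' B : 0 <= K -> ccn K g -> ccn K g' ->
  (forall s : seq (windex n), uniq s -> (forall w, w \in s -> Omega w) ->
    \sum_(w <- s) `|wcoef phi psi g w * wcoef phi psi g' w| <= B) ->
  intRn (fun x => g x * g' x) <= B.
Proof.
move=> K0 cg cg' H.
have [_ _ _ _ P] := dau.
have cN := ccnN cg'.
have cp := ccnD cg cg'; have cm := ccnD cg cN.
have Ep := P _ cp.1 (ccn_compact_support K0 cp).
have Em := P _ cm.1 (ccn_compact_support K0 cm).
set a := wcoef phi psi g; set b := wcoef phi psi g'.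
have SS : (\esum_(w in @Omega n) ((wcoef phi psi (fun x => g x + g' x)%R w) ^+ 2)%:E <=
    \esum_(w in @Omega n) ((wcoef phi psi (fun x => g x - g' x)%R w) ^+ 2)%:E
    + 4%:E * B%:E)%E.
  apply: (@le_trans _ _ (\esum_(w in @Omega n) (((wcoef phi psi (fun x => g x - g' x)%R w) ^+ 2)%:E
     + (4 * `|a w * b w|)%:E))%E).
    apply: le_esum => w wO.
    rewrite (wcoefD K0 cg cg' wO) (wcoefD K0 cg cN wO) (wcoefN K0 cg' wO).
    rewrite -EFinD lee_fin -/(a w) -/(b w).
    have := ler_norm (a w * b w); set t := `|_| => ab.
    rewrite [leLHS](_ : _ = (a w - b w) ^+ 2 + 4 * (a w * b w)); last by ring.
    by rewrite lerD2l ler_pM2l.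
  rewrite esumD; last 2 first.
  - by move=> w _; rewrite lee_fin sqr_ge0.
  - by move=> w _; rewrite lee_fin mulr_ge0.
  apply: leeD => //; rewrite -EFinM; apply: esum_le_seq => s us sO.
  by rewrite -mulr_sumr ler_pM2l//; exact: H.
move: SS; rewrite Em Ep -EFinM -EFinD lee_fin => SS.
have c2p : ccn K (fun x => (g x + g' x) ^+ 2).
  by have := ccnMl cp cp.1; congr (ccn K _); apply/funext => x; rewrite expr2.
have c2m : ccn K (fun x => (g x - g' x) ^+ 2).
  by have := ccnMl cm cm.1; congr (ccn K _); apply/funext => x; rewrite expr2.
have := intRnB K0 c2p c2m.
rewrite (_ : (fun x => _) = (fun x => 4 * (g x * g' x))); last first.
  by apply/funext => x; ring.
rewrite (intRnZ _ K0 (ccnMl cg' cg.1)) => E.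
have : 4 * intRn (fun x => g x * g' x) <= 4 * B by rewrite E lerBlDl.
by rewrite ler_pM2l.
Qed.

Lemma parseval_norm_le K g g' B : 0 <= K -> ccn K g -> ccn K g' ->
  (forall s : seq (windex n), uniq s -> (forall w, w \in s -> Omega w) ->
    \sum_(w <- s) `|wcoef phi psi g w * wcoef phi psi g' w| <= B) ->
  `|intRn (fun x => g x * g' x)| <= B.
Proof.
move=> K0 cg cg' H; rewrite ler_norml; apply/andP; split; last exact: (parseval_le K0 cg cg' H).
rewrite lerNl -mulN1r -(intRnZ _ K0 (ccnMl cg' cg.1)).
rewrite (_ : (fun x => _) = (fun x => (- g x) * g' x)); last first.
  by apply/funext => x; rewrite mulrA mulN1r.
apply: (parseval_le K0 (ccnN cg) cg') => s us sO.
apply: le_trans (H s us sO); rewrite big_seq [leRHS]big_seq; apply: ler_sum => w ws.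
by rewrite (wcoefN K0 cg (sO w ws)) mulNr normrN.
Qed.

End Parseval.

(** * Finite differences *)

Section Differences.
Context {R : realType} {n : nat}.
Local Notation pt := 'rV[R]_n.
Implicit Types (K B : R) (g G F : pt -> R) (x y z h v : pt) (r k : nat).

Lemma sdiffnS r h g x : sdiffn r.+1 h g x =
  sdiffn r h g (x + 2^-1 *: h) - sdiffn r h g (x - 2^-1 *: h).
Proof. by []. Qed.

Lemma sdiffnSr r h g : sdiffn r.+1 h g = sdiffn r h (sdiff h g).
Proof. by rewrite /sdiffn iterSr. Qed.

Lemma sdiffnD r k h g : sdiffn (r + k) h g = sdiffn r h (sdiffn k h g).
Proof. by rewrite /sdiffn iterD. Qed.

Lemma sdiff_continuous h g : continuous g -> continuous (sdiff h g).
Proof. by move=> cg; apply: rv_cD; [|apply: rv_cN]; exact: rv_ctrans. Qed.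

Lemma sdiffn_continuous r h g : continuous g -> continuous (sdiffn r h g).
Proof. by move=> cg; elim: r => // r IH; exact: sdiff_continuous. Qed.

Lemma sdiffn_norm_le r h g B : (forall x, `|g x| <= B) ->
  forall x, `|sdiffn r h g x| <= 2 ^+ r * B.
Proof.
move=> gB; elim: r => [|r IH] x; first by rewrite expr0 mul1r.
rewrite sdiffnS exprS -mulrA mulr_natl mulr2n.
by apply: le_trans (ler_normB _ _) _; apply: lerD.
Qed.

Lemma sdiffn_affine r h g (a : R) (b : pt) x :
  sdiffn r h (fun x => g (a *: x + b)) x = sdiffn r (a *: h) g (a *: x + b).
Proof.
elim: r x => // r IH x; rewrite !sdiffnS !IH.
by congr (_ - _); congr sdiffn;
  rewrite ?scalerDr ?scalerN !scalerA [2^-1 * a]mulrC addrAC.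
Qed.

Lemma sdiffnZ r h g (c : R) x : sdiffn r h (fun x => c * g x) x = c * sdiffn r h g x.
Proof. by elim: r x => // r IH x; rewrite !sdiffnS !IH mulrBr. Qed.

(** Localises differences: it controls their supports and later finds the wavelets that contribute
    near a given point. *)
Lemma sdiffn_neq0 r h g x : sdiffn r h g x != 0 ->
  exists2 p : 'I_r.+1, true & g (x + (p%:R - r%:R / 2) *: h) != 0.
Proof.
elim: r x => [|r IH] x.
  by exists ord0 => //; rewrite mul0r subr0 scale0r addr0.
rewrite sdiffnS => H.
have [H1|H1] := eqVneq (sdiffn r h g (x + 2^-1 *: h)) 0; last first.
  have [p _ gp] := IH _ H1; exists (lift ord0 p) => //=.
  move: gp; rewrite -addrA -scalerDl; congr (g (_ + _ *: _) != 0).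
  by rewrite /bump/= add1n -!natr1; field.
have H2 : sdiffn r h g (x - 2^-1 *: h) != 0.
  by move: H; rewrite H1 sub0r oppr_eq0.
have [p _ gp] := IH _ H2; exists (widen_ord (leqnSn _) p) => //=.
move: gp; rewrite -addrA -scaleNr -scalerDl; congr (g (_ + _ *: _) != 0).
by rewrite -!natr1; field.
Qed.

Lemma sdiffn_ccn K r h g : ccn K g -> ccn (K + r%:R * `|h|) (sdiffn r h g).
Proof.
move=> [cg g0]; split; first exact: sdiffn_continuous.
move=> x Kx; apply/eqP; apply: contraTT isT => /sdiffn_neq0[p _].
rewrite g0 ?eqxx//.
have pr : `|p%:R - r%:R / 2| <= r%:R :> R.
  have : (p : nat)%:R <= r%:R :> R by rewrite ler_nat -ltnS.
  have : 0 <= (p : nat)%:R :> R by [].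
  by move=> ? ?; rewrite ler_norml; apply/andP; split; lra.
have := ler_normB (x + (p%:R - r%:R / 2) *: h) ((p%:R - r%:R / 2) *: h).
rewrite addrK normrZ.
have := ler_wpM2r (normr_ge0 h) pr.
by lra.
Qed.

Lemma intRn_trans K G (b : pt) : 0 <= K -> ccn K G ->
  intRn (fun x => G (x + b)) = intRn G.
Proof.
move=> K0 cG; have := intRn_affine b K0 (oner_neq0 R) cG.
rewrite normr1 expr1n invr1 mul1r => <-.
by congr intRn; apply/funext => x; rewrite scale1r.
Qed.

Lemma ccn_trans K G (b : pt) : ccn K G -> ccn (K + `|b|) (fun x => G (x + b)).
Proof.
move=> cG; have := ccn_affine b (oner_neq0 R) cG.
rewrite normr1 divr1; congr (ccn _ _).
by apply/funext => x; rewrite scale1r.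
Qed.

(** Summation by parts: each half-step translate is shifted from one factor to the other by
    translation invariance, which exchanges the two signs. *)
Lemma intRn_sdiff K F G h : 0 <= K -> continuous F -> ccn K G ->
  intRn (fun x => F x * sdiff h G x) = - intRn (fun x => G x * sdiff h F x).
Proof.
move=> K0 cF cG; pose u := 2^-1 *: h; pose K1 := K + `|u|.
have K10 : 0 <= K1 by rewrite addr_ge0.
have KK : K <= K1 by rewrite lerDl.
have c1 : ccn K1 (fun x => F x * G (x + u)).
  by apply: ccnMl => //; exact: ccn_trans.
have c2 : ccn K1 (fun x => F x * G (x - u)).
  by apply: ccnMl => //; have := ccn_trans (- u) cG; rewrite normrN.
have c3 : ccn K1 (fun x => G x * F (x + u)).
  by apply: ccnMr; [exact: ccnW cG|exact: rv_ctrans].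
have c4 : ccn K1 (fun x => G x * F (x - u)).
  by apply: ccnMr; [exact: ccnW cG|exact: rv_ctrans].
transitivity (intRn (fun x => F x * G (x + u)) - intRn (fun x => F x * G (x - u))).
  rewrite -(intRnB K10 c1 c2); congr intRn; apply/funext => x.
  by rewrite /sdiff mulrBr.
transitivity (- (intRn (fun x => G x * F (x + u)) - intRn (fun x => G x * F (x - u)))).
  rewrite opprB -(intRn_trans (- u) K10 c1) -(intRn_trans u K10 c2).
  congr (_ - _); congr intRn; apply/funext => x; rewrite ?subrK ?addrK mulrC//.
congr (- _); rewrite -(intRnB K10 c3 c4); congr intRn; apply/funext => x.
by rewrite /sdiff mulrBr.
Qed.

Lemma intRn_sdiffn K F G h r : 0 <= K -> continuous F -> ccn K G ->
  intRn (fun x => F x * sdiffn r h G x) =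
  (- 1) ^+ r * intRn (fun x => G x * sdiffn r h F x).
Proof.
move=> K0; elim: r F => [|r IH] F cF cG.
  by rewrite expr0 mul1r; congr intRn; apply/funext => x; rewrite mulrC.
have K1 : 0 <= K + r%:R * `|h| by rewrite addr_ge0// mulr_ge0.
rewrite (intRn_sdiff _ K1 cF (sdiffn_ccn r h cG)).
rewrite (_ : (fun x => _) = (fun x => sdiff h F x * sdiffn r h G x)); last first.
  by apply/funext => x; rewrite mulrC.
rewrite IH//; last exact: sdiff_continuous.
by rewrite -sdiffnSr exprS mulN1r mulNr.
Qed.

Lemma is_derive_trans g v b x (d : R) :
  is_derive (x + b) v g d -> is_derive x v (fun x => g (x + b)) d.
Proof.
have E : (fun t : R => t^-1 *: (((fun x => g (x + b)) \o shift x) (t *: v) - g (x + b)))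
    = (fun t : R => t^-1 *: ((g \o shift (x + b)) (t *: v) - g (x + b))).
  by apply/funext => t /=; rewrite addrA.
by move=> [ex val]; split; [rewrite /derivable E|rewrite /derive E].
Qed.

Lemma is_derive_line g z v (t d : R) :
  is_derive (z + t *: v) v g d -> is_derive t 1 (fun t : R => g (z + t *: v)) d.
Proof.
have E : (fun s : R => s^-1 *: (((fun t : R => g (z + t *: v)) \o shift t) (s *: 1) - g (z + t *: v)))
    = (fun s : R => s^-1 *: ((g \o shift (z + t *: v)) (s *: v) - g (z + t *: v))).
  apply/funext => s /=; rewrite addrCA -scalerDl.
  by congr (_ *: (g (_ + (_ + _) *: _) - _)); rewrite /GRing.scale/= mulr1.
by move=> [ex val]; split; [rewrite /derivable E|rewrite /derive E].
Qed.

Lemma is_derive_sdiffn g dg v h r : (forall x, is_derive x v g (dg x)) ->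
  forall x, is_derive x v (sdiffn r h g) (sdiffn r h dg x).
Proof.
move=> H; elim: r => // r IH x; rewrite sdiffnS.
have := @is_deriveB _ _ _ (fun x => sdiffn r h g (x + 2^-1 *: h))
  (fun x => sdiffn r h g (x - 2^-1 *: h)) x v _ _
  (is_derive_trans (IH _)) (is_derive_trans (IH _)).
by [].
Qed.

Lemma line_increment F dF v B z (t : R) : continuous F ->
  (forall x, is_derive x v F (dF x)) -> (forall x, `|dF x| <= B) ->
  `|F (z + t *: v) - F z| <= B * `|t|.
Proof.
move=> cF H dB.
have pos y (u : R) : 0 <= u -> `|F (y + u *: v) - F y| <= B * u.
  move=> u0.
  have [|c _ E] := @MVT_segment R (fun s => F (y + s *: v)) (fun s => dF (y + s *: v))
      0 u u0 (fun s _ => is_derive_line (H _)).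
    apply: continuous_subspaceT => s.
    apply/cvgrPdist_lt => e e0; have /rv_continuousP/(_ _ e0)[d d0 dH] := cF (y + s *: v).
    apply/nbhs_normP; exists (d / (`|v| + 1)); first by rewrite /= divr_gt0// ltr_wpDl.
    move=> w /=; rewrite ltr_pdivlMr ?ltr_wpDl// => sw; apply: dH.
    rewrite opprD addrACA subrr add0r -scalerBl normrZ.
    by apply: le_lt_trans sw; rewrite ler_wpM2l// lerDl.
  move: E; rewrite scale0r addr0 subr0 => ->.
  by rewrite normrM (ger0_norm u0) ler_wpM2r.
have [t0|t0] := leP 0 t; first by rewrite (ger0_norm t0); exact: pos.
rewrite distrC (ltr0_norm t0).
have := pos (z + t *: v) (- t); rewrite scaleNr addrK; apply.
by rewrite oppr_ge0 ltW.
Qed.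

(** Only partial derivatives are at hand, so the path from y to x changes one coordinate at a time
    and the mean value theorem is applied on each leg. *)
Lemma coord_increment F (dF : 'I_n -> pt -> R) B x y : continuous F ->
  (forall i x, is_derive x (delta_mx ord0 i) F (dF i x)) ->
  (forall i x, `|dF i x| <= B) -> `|F x - F y| <= n%:R * B * `|x - y|.
Proof.
move=> cF H dB.
pose p k : pt := \row_(i < n) (if (i < k)%N then x ord0 i else y ord0 i).
have p0 : p 0%N = y by apply/rowP => i; rewrite mxE.
have pn : p n = x by apply/rowP => i; rewrite mxE ltn_ord.
suff S k : (k <= n)%N -> `|F (p k) - F y| <= k%:R * B * `|x - y|.
  by have := S n (leqnn n); rewrite pn.
elim: k => [_|k IH kn]; first by rewrite p0 subrr normr0 !mul0r.
have B0 : 0 <= B by apply: le_trans (dB (Ordinal kn) x); exact: normr_ge0.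
rewrite -(subrKA (F (p k))) -[k.+1%:R]nat1r !mulrDl mul1r.
apply: le_trans (ler_normD _ _) _; apply: lerD; last exact: IH (ltnW kn).
pose i := Ordinal kn.
have -> : p k.+1 = p k + (x ord0 i - y ord0 i) *: delta_mx ord0 i.
  apply/rowP => c; rewrite !mxE eqxx/= ltnS leq_eqVlt.
  have [->|ci] := eqVneq c i; first by rewrite eqxx ltnn/= mulr1 addrC subrK.
  by rewrite mulr0 addr0 (_ : (c == k :> nat) = false)//; apply/negbTE.
apply: le_trans (line_increment _ _ cF (H i) (dB i)) _.
rewrite ler_wpM2l//; have := rv_norm_coord (x - y) i.
by rewrite !mxE.
Qed.

Lemma derive_ccn_eq0 K g v x : ccn K g -> K < `|x| -> 'D_v g x = 0.
Proof.
move=> [cg g0] Kx; apply: cvg_lim => //; apply: cvg_near_cst.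
have v1 : 0 < `|v| + 1 by rewrite ltr_wpDl.
have e0 : 0 < (`|x| - K) / (`|v| + 1) by rewrite divr_gt0// subr_gt0.
near=> t; rewrite /= g0 ?(g0 x)// ?subrr ?scaler0//.
have : `|t| < (`|x| - K) / (`|v| + 1) by near: t; exact: dnbhs0_lt.
rewrite ltr_pdivlMr// mulrDr mulr1 => h.
have := ler_normB (t *: v + x) (t *: v); rewrite addrAC subrr add0r normrZ.
have := normr_ge0 t; lra.
Unshelve. all: by end_near. Qed.

Lemma CLW k g : CL k.+1 g -> CL k g.
Proof.
elim: k g => [|k IH] g; first by case.
move=> [cg H]; split => // i; have [d1 d2] := H i.
by split => //; exact: IH.
Qed.

Lemma CL_le k r g : (k <= r)%N -> CL r g -> CL k g.
Proof. by move=> /subnK <-; elim: (r - k)%N => // m IH /CLW. Qed.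

(** Differences commute with partial derivatives. The outermost difference is an increment over h of
    [sdiffn k h g], whose partial derivatives are k-th differences of those of g, of size |h|^k by
    induction. *)
Lemma sdiffn_smooth k K g : CL k g -> ccn K g ->
  exists2 C : R, 0 <= C & forall h x, `|sdiffn k h g x| <= C * `|h| ^+ k.
Proof.
elim: k g => [|k IH] g Cg cg.
  have [B B0 gB] := ccn_bounded cg.
  by exists B => // h x; rewrite expr0 mulr1.
have [_ H] := Cg.
pose dg i := fun x => 'D_(delta_mx ord0 i) g x.
have cdg i : ccn K (dg i).
  split; first exact: CL_continuous (H i).2.
  by move=> x Kx; exact: derive_ccn_eq0 cg Kx.
have ex i : {C : R | 0 <= C /\ forall h x, `|sdiffn k h (dg i) x| <= C * `|h| ^+ k}.
  by apply: cid; have [C C0 CH] := IH (dg i) (H i).2 (cdg i); exists C.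
pose C := \sum_i (sval (ex i)).
have C0 : 0 <= C by apply: sumr_ge0 => i _; have [] := svalP (ex i).
exists (n%:R * C) => [|h x]; first by rewrite mulr_ge0.
rewrite sdiffnS.
have D i z : is_derive z (delta_mx ord0 i) (sdiffn k h g) (sdiffn k h (dg i) z).
  by apply: is_derive_sdiffn => w; apply: derivableP; exact: (H i).1.
have bD i z : `|sdiffn k h (dg i) z| <= C * `|h| ^+ k.
  apply: le_trans ((svalP (ex i)).2 h z) _.
  rewrite ler_wpM2r ?exprn_ge0// /C (bigD1 i)//= lerDl.
  by apply: sumr_ge0 => j _; have [] := svalP (ex j).
apply: le_trans (coord_increment _ _ _ D bD) _.
  exact: sdiffn_continuous cg.1.
rewrite opprB addrC addrA subrK -scalerDl.
rewrite (_ : 2^-1 + 2^-1 = 1 :> R); last by field.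
by rewrite scale1r exprSr !mulrA.
Qed.

(** Recentring by k/2 steps puts the sample points at x + m h; the term m = 0 is (-1)^k g(x), so g
    is compared with combinations of its translates. Induction by Pascal's rule. *)
Lemma sdiffn_forward k h g x :
  sdiffn k h g (x + (k%:R / 2) *: h) =
  \sum_(m < k.+1) (- 1) ^+ (k - m) * 'C(k, m)%:R * g (x + m%:R *: h).
Proof.
elim: k g x => [|k IH] g x.
  by rewrite big_ord_recl big_ord0 /= mul0r subnn expr0 bin0 !mul1r addr0.
rewrite sdiffnSr.
rewrite (_ : x + _ = (x + 2^-1 *: h) + (k%:R / 2) *: h); last first.
  by rewrite -addrA -scalerDl; congr (_ + _ *: _); rewrite -natr1; field.
rewrite IH /sdiff.
have E1 m : x + 2^-1 *: h + m%:R *: h + 2^-1 *: h = x + m.+1%:R *: h.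
  by rewrite -!addrA -!scalerDl; congr (_ + _ *: _); rewrite -natr1; field.
have E2 m : x + 2^-1 *: h + m%:R *: h - 2^-1 *: h = x + m%:R *: h.
  by rewrite [x + _ + _]addrAC addrK.
under eq_bigr => m _ do rewrite E1 E2 mulrBr.
rewrite sumrB; set S1 := \sum_(m < _) _; set S2 := \sum_(m < _) _.
rewrite big_ord_recl big_ord_recr/=.
have -> : S1 = (-1) ^+ (k - k) * 'C(k, k)%:R * g (x + k.+1%:R *: h) +
   \sum_(m < k) (-1) ^+ (k - m) * 'C(k, m)%:R * g (x + m.+1%:R *: h).
  by rewrite /S1 big_ord_recr/= addrC.
have -> : S2 = (-1) ^+ k * g x +
   \sum_(m < k) (-1) ^+ (k - m.+1) * 'C(k, m.+1)%:R * g (x + m.+1%:R *: h).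
  by rewrite /S2 big_ord_recl/= subn0 bin0 mulr1 scale0r addr0.
have E3 : \sum_(i < k) (-1) ^+ (k.+1 - bump 0 i) * 'C(k.+1, bump 0 i)%:R * g (x + (bump 0 i)%:R *: h) =
    \sum_(m < k) (-1) ^+ (k - m) * 'C(k, m)%:R * g (x + m.+1%:R *: h) -
    \sum_(m < k) (-1) ^+ (k - m.+1) * 'C(k, m.+1)%:R * g (x + m.+1%:R *: h).
  rewrite -sumrB; apply: eq_bigr => m _.
  rewrite /bump/= add1n subSS -mulrBl; congr (_ * _).
  rewrite binS natrD -[(k - m)%N]prednK ?subn_gt0// -subnS.
  by rewrite exprS; ring.
rewrite E3 /bump/= add1n !subnn !binn !subn0 !bin0 !scale0r !addr0 exprS.
by ring.
Qed.

End Differences.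

(** * Grids and a truncated power bump *)

Section Grid.
Context {R : realType} {n : nat}.
Local Notation pt := 'rV[R]_n.
Implicit Types (K B : R) (G : pt -> R) (x y u : pt) (k Q : nat).

(** The recursion mirrors [iterint]: coordinates of index below k run over the left endpoints of the
    cells of mesh 1/Q in [-1, 1], the others stay those of x. *)
Fixpoint grid Q k x : seq pt :=
  match k with
  | 0 => [:: x]
  | k'.+1 => flatten [seq grid Q k' (setc x k' (Q%:R^-1 *+ q - 1)) |
                      q <- index_iota 0 Q.*2]
  end.

Lemma grid_norm Q k x u : `|x| <= 1 -> u \in grid Q k x -> `|u| <= 1.
Proof.
elim: k x => [|k IH] x x1 /=; first by rewrite inE => /eqP ->.
move=> /flattenP[s /mapP[q]]; rewrite mem_index_iota => /andP[_ qQ] ->.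
apply: IH; apply: rv_norm_le => // i; rewrite setcE; case: ifP => _.
  case: Q qQ => // Q qQ; rewrite ler_norml lerBDr lerBlDr.
  rewrite -[Q.+1%:R^-1 *+ q]mulr_natl ler_pdivrMr// addNr mulr_ge0//=.
  have -> : 1 + 1 = 2 :> R by [].
  by rewrite -natrM ler_nat mul2n ltnW.
exact: le_trans (rv_norm_coord _ _) x1.
Qed.

Lemma big_grid Q k x (F : pt -> R) :
  \sum_(u <- grid Q k.+1 x) F u =
  \sum_(q < Q.*2) \sum_(u <- grid Q k (setc x k (Q%:R^-1 *+ q - 1))) F u.
Proof. by rewrite /= big_flatten big_map big_mkord. Qed.

(** A new coordinate adds the Riemann error of a slice with modulus 2^k e, namely 2^(k+1) e, and
    doubles the old error, since the 2Q cells have total length 2. *)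
Lemma grid_riemann Q G e k x : (0 < Q)%N -> ccn 1 G -> (k <= n)%N ->
  (forall x y, `|x - y| <= Q%:R^-1 -> `|G x - G y| <= e) ->
  `|iterint k G x - \sum_(u <- grid Q k x) Q%:R ^- k * G u| <= k%:R * 2 ^+ k * e.
Proof.
move=> Q0 cG + Ge; elim: k x => [|k IH] x kn.
  by rewrite /= big_seq1 expr0 invr1 mul1r subrr normr0 !mul0r.
pose h : R := Q%:R^-1.
have h0 : 0 <= h by rewrite invr_ge0.
have hQ : h *+ Q = 1 by rewrite -mulr_natl divff// pnatr_eq0 -lt0n.
pose H t := iterint k G (setc x k t).
have cH : cc1 1 H by exact: (iterint_cc1 x ler01 cG kn).
have mH (t v : R) : `|t - v| <= h -> `|H t - H v| <= 2 ^+ k * e.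
  move=> tu; have := (iterint_modulus ler01 cG (ltnW kn)).1 _ _ Ge.
  rewrite mulr1; apply; apply: le_trans (setcB_norm1 _ _ _ _) tu.
have H1 := int1_riemann h0 hQ cH mH.
rewrite big_grid.
set S1 := \sum_(q < _) _ in H1; set S2 := \sum_(q < _) _.
have H2 : `|S1 - S2| <= 2 * (k%:R * 2 ^+ k * e).
  rewrite /S1 /S2 -sumrB; apply: le_trans (ler_norm_sum _ _ _) _.
  have -> : 2 * (k%:R * 2 ^+ k * e) = \sum_(q < Q.*2) h * (k%:R * 2 ^+ k * e).
    rewrite sumr_const card_ord -mulrnAl; congr (_ * _).
    by rewrite -addnn mulrnDr hQ.
  apply: ler_sum => q _.
  rewrite (_ : \sum_(u <- _) _ =
     h * \sum_(u <- grid Q k (setc x k (h *+ q - 1))) Q%:R ^- k * G u); last first.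
    rewrite mulr_sumr; apply: eq_bigr => u _.
    by rewrite exprS invfM mulrA.
  by rewrite -mulrBr normrM (ger0_norm h0) ler_wpM2l//; exact: IH (ltnW kn).
rewrite -(subrKA S1); apply: le_trans (ler_normD _ _) _.
apply: le_trans (lerD H1 H2) _; rewrite -natr1 exprS.
by rewrite le_eqVlt; apply/orP; left; apply/eqP; ring.
Qed.

End Grid.

(** * The truncated power bump *)

Section Bump.
Context {R : realType} {n : nat}.
Local Notation pt := 'rV[R]_n.
Variable p : nat.
Hypothesis p_gt0 : (0 < p)%N.
Implicit Types (u x z : pt).

Definition sqn u : R := \sum_(i < n) u ord0 i ^+ 2.
Definition bumpf u : R := Num.max 0 (1 - sqn u) ^+ p.

Lemma sqn_ge0 u : 0 <= sqn u.
Proof. by apply: sumr_ge0 => *; exact: sqr_ge0. Qed.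

Lemma sqn_continuous : continuous sqn.
Proof. by apply: rv_csum => i; apply: rv_cX; exact: rv_ccoord. Qed.

Lemma rv_cmax0 (G : pt -> R) : continuous G -> continuous (fun x => Num.max 0 (G x)).
Proof.
move=> cG.
have -> : (fun x => Num.max 0 (G x)) = (fun x => 2^-1 * (G x + `|G x|)).
  apply/funext => x; have [g0|g0] := leP 0 (G x).
    by rewrite ger0_norm//; field.
  by rewrite ltr0_norm// subrr mulr0.
apply: rv_cZ; apply: rv_cD => // x.
by apply: (@continuous_comp _ _ _ G); [exact: cG|exact: norm_continuous].
Qed.

Lemma bumpf_continuous : continuous bumpf.
Proof.
apply: rv_cX; apply: rv_cmax0; apply: rv_cD; first exact: rv_cst.
by apply: rv_cN; exact: sqn_continuous.
Qed.

Lemma bumpf_ge0 u : 0 <= bumpf u.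
Proof. by rewrite exprn_ge0// le_max lexx. Qed.

Lemma bumpf_le1 u : bumpf u <= 1.
Proof.
rewrite exprn_ile1// ?le_max ?lexx// ge_max ler01/= gerBl.
exact: sqn_ge0.
Qed.

Lemma bumpf_ccn : ccn 1 bumpf.
Proof.
split; first exact: bumpf_continuous.
move=> u /(rv_norm_gt ler01)[i ui].
rewrite /bumpf (_ : Num.max 0 _ = 0) ?expr0n ?gtn_eqF//.
apply/max_idPl; rewrite subr_le0 /sqn (bigD1 i)//=.
rewrite -real_normK ?num_real//.
have : 1 <= `|u ord0 i| ^+ 2 by rewrite expr_ge1// ltW.
have : 0 <= \sum_(j < n | j != i) u ord0 j ^+ 2.
  by apply: sumr_ge0 => *; exact: sqr_ge0.
lra.
Qed.

Lemma bumpf_ge_half u : n%:R * `|u| ^+ 2 <= 2^-1 -> 2^-1 ^+ p <= bumpf u.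
Proof.
move=> h; apply: lerXn2r; rewrite ?nnegrE ?le_max ?lexx ?invr_ge0//.
apply/orP; right.
suff : sqn u <= n%:R * `|u| ^+ 2 by lra.
rewrite /sqn -[n in n%:R]card_ord -sum1_card natr_sum mulr_suml; apply: ler_sum => i _.
by rewrite mul1r -real_normK ?num_real// ler_sqr ?nnegrE// rv_norm_coord.
Qed.

(** If a and a + t are nonnegative, the error is exactly t^p. If a >= 0 > a + t, the sum is (a +
    t)^p - t^p and |a + t| <= |t|. If a < 0, all terms vanish because p - b > 0, and max(0, a + t)
    <= |t|. *)
Lemma trunc_power_taylor (a t : R) :
  `|Num.max 0 (a + t) ^+ p -
    \sum_(b < p) 'C(p, b)%:R * Num.max 0 a ^+ (p - b) * t ^+ b| <= 2 * `|t| ^+ p.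
Proof.
have T0 : 0 <= `|t| ^+ p by rewrite exprn_ge0.
have [a0|a0] := leP 0 a.
  have E : (a + t) ^+ p =
      \sum_(b < p) 'C(p, b)%:R * a ^+ (p - b) * t ^+ b + t ^+ p.
    rewrite exprDn big_ord_recr/= subnn expr0 mul1r binn mulr1n; congr (_ + _).
    by apply: eq_bigr => b _; rewrite -mulrA mulr_natl.
  have [at0|at0] := leP 0 (a + t).
    rewrite E [X in `|X|](_ : _ = t ^+ p); last by ring.
    by rewrite normrX ler_peMl// ler1n.
  rewrite expr0n gtn_eqF// sub0r normrN.
  have -> : \sum_(b < p) 'C(p, b)%:R * a ^+ (p - b) * t ^+ b = (a + t) ^+ p - t ^+ p.
    by rewrite E addrK.
  apply: le_trans (ler_normB _ _) _; rewrite !normrX mulr_natl mulr2n lerD2r.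
  by rewrite lerXn2r ?nnegrE// !ltr0_norm//; lra.
rewrite big1 ?subr0; last first.
  by move=> b _; rewrite expr0n subn_eq0 leqNgt ltn_ord/= mulr0 mul0r.
have M0 : 0 <= Num.max 0 (a + t) by rewrite le_max lexx.
apply: (@le_trans _ _ (`|t| ^+ p)); last by rewrite ler_peMl// ler1n.
rewrite normrX lerXn2r ?nnegrE// (ger0_norm M0) ge_max normr_ge0/=.
by apply: le_trans (ler_norm t); lra.
Qed.

End Bump.

(** * Vanishing moments *)

Section Moments.
Context {R : realType} {n : nat}.
Local Notation pt := 'rV[R]_n.
Variables (L : nat) (K : R) (ps : pt -> R).
Hypothesis K0 : 0 <= K.
Hypothesis cps : ccn K ps.
Hypothesis moments : forall a : 'I_n -> nat, (\sum_(i < n) a i <= L)%N ->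
  intRn (fun x => (\prod_(i < n) x ord0 i ^+ a i) * ps x) = 0.
Implicit Types (P : pt -> R) (x z : pt) (d : nat).

Definition mono (a : 'I_n -> nat) x : R := \prod_(i < n) x ord0 i ^+ a i.

Lemma mono_continuous a : continuous (mono a).
Proof.
rewrite /mono; elim: (index_enum _) => [|i r IH].
  by under eq_fun do rewrite big_nil; exact: rv_cst.
under eq_fun do rewrite big_cons.
by apply: rv_cM => //; apply: rv_cX; exact: rv_ccoord.
Qed.

(** P behaves towards the moments of [ps] like a polynomial of degree at most d. Multiplication by a
    coordinate raises d by one, so products of linear and quadratic forms need no expansion into
    monomials. *)
Definition mom d P := continuous P /\
  forall a, (\sum_(i < n) a i + d <= L)%N ->
    intRn (fun x => mono a x * P x * ps x) = 0.

Lemma mom_ccn d P a : mom d P -> ccn K (fun x => mono a x * P x * ps x).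
Proof.
by move=> [cP _]; apply: ccnMl => //; apply: rv_cM => //; exact: mono_continuous.
Qed.

Lemma mom_cst (c : R) : mom 0 (fun=> c).
Proof.
split; first exact: rv_cst.
move=> a; rewrite addn0 => aL.
have cm : ccn K (fun x => mono a x * ps x) by apply: ccnMl => //; exact: mono_continuous.
rewrite (_ : (fun x => _) = (fun x => c * (mono a x * ps x))).
  by rewrite (intRnZ _ K0 cm) moments// mulr0.
by apply/funext => x; rewrite mulrA [c * _]mulrC.
Qed.

Lemma momD d P P' : mom d P -> mom d P' -> mom d (fun x => P x + P' x).
Proof.
move=> mP mP'; split; first by apply: rv_cD; [exact: mP.1|exact: mP'.1].
move=> a aL.
rewrite (_ : (fun x => _) =
    (fun x => mono a x * P x * ps x + mono a x * P' x * ps x)); last first.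
  by apply/funext => x; rewrite mulrDr mulrDl.
by rewrite (intRnD K0 (mom_ccn a mP) (mom_ccn a mP')) mP.2// mP'.2// addr0.
Qed.

Lemma momZ d (c : R) P : mom d P -> mom d (fun x => c * P x).
Proof.
move=> mP; split; first by apply: rv_cZ; exact: mP.1.
move=> a aL.
rewrite (_ : (fun x => _) = (fun x => c * (mono a x * P x * ps x))); last first.
  by apply/funext => x; ring.
by rewrite (intRnZ _ K0 (mom_ccn a mP)) mP.2// mulr0.
Qed.

Lemma momW d d' P : (d <= d')%N -> mom d P -> mom d' P.
Proof.
move=> dd [cP H]; split => // a aL; apply: H.
by apply: leq_trans aL; rewrite leq_add2l.
Qed.

Lemma mom_sum (I : Type) (r : seq I) d (F : I -> pt -> R) :
  (forall i, mom d (F i)) -> mom d (fun x => \sum_(i <- r) F i x).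
Proof.
move=> mF; elim: r => [|i r IH].
  by under eq_fun do rewrite big_nil; exact: momW (mom_cst 0).
by under eq_fun do rewrite big_cons; exact: momD.
Qed.

Lemma momX d (i : 'I_n) P : mom d P -> mom d.+1 (fun x => x ord0 i * P x).
Proof.
move=> [cP H]; split; first by apply: rv_cM => //; exact: rv_ccoord.
move=> a aL; pose a' := fun j => (a j + (j == i))%N.
rewrite (_ : (fun x => _) = (fun x => mono a' x * P x * ps x)).
  apply: H; rewrite big_split/= -[(\sum_(j < n) (j == i))%N]big_mkcond/=.
  by rewrite big_pred1_eq -addnA add1n.
apply/funext => x; rewrite [mono a x * _]mulrA; congr (_ * _ * _).
rewrite /mono (bigD1 i)//= [RHS](bigD1 i)//= /a' eqxx addn1 exprSr mulrAC; congr (_ * _).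
by apply: eq_bigr => j /negbTE ->; rewrite addn0.
Qed.

Lemma mom_lin d (c : 'I_n -> R) P : mom d P ->
  mom d.+1 (fun x => (\sum_(i < n) c i * x ord0 i) * P x).
Proof.
move=> mP; under eq_fun do rewrite mulr_suml.
by apply: mom_sum => i; under eq_fun do rewrite -mulrA; apply: momZ; exact: momX.
Qed.

Lemma mom_sqn d P : mom d P -> mom d.+2 (fun x => sqn x * P x).
Proof.
move=> mP; under eq_fun do rewrite mulr_suml.
apply: mom_sum => i; under eq_fun do rewrite expr2 -mulrA.
by apply: momX; exact: momX.
Qed.

Lemma mom_intRn d P : (d <= L)%N -> mom d P -> intRn (fun x => P x * ps x) = 0.
Proof.
move=> dL [_ /(_ (fun=> 0%N))]; rewrite sum_nat_const muln0 add0n => /(_ dL) <-.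
congr intRn; apply/funext => x; by rewrite /mono big1 ?mul1r.
Qed.

Lemma mom_bihom (l : 'I_n -> R) (c : R) (b d : nat) :
  mom (b + d.*2) (fun x => (\sum_(i < n) l i * x ord0 i) ^+ b * (c * sqn x) ^+ d).
Proof.
elim: b => [|b IH].
  under eq_fun do rewrite expr0 mul1r.
  elim: d => [|d IH]; first by under eq_fun do rewrite expr0; exact: mom_cst.
  under eq_fun do rewrite exprS -mulrA.
  by apply: momZ; exact: mom_sqn.
by under eq_fun do rewrite exprS -mulrA; exact: mom_lin.
Qed.

(** At z - x/M the base of the power is a + ([ell] + [qq]), with [ell] linear in x of order 1/M and
    [qq] quadratic of order 1/M^2. Truncating in this perturbation leaves a polynomial of degree
    below p, which [ps] annihilates. *)
Lemma bumpf_taylor (p : nat) (Z : R) : (0 < p <= L)%N -> 0 <= Z ->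
  exists2 C : R, 0 <= C & forall (M : R) z, 1 <= M -> `|z| <= Z ->
    exists P : pt -> R, [/\ continuous P, intRn (fun x => P x * ps x) = 0 &
      forall x, `|x| <= K -> `|bumpf p (z - M^-1 *: x) - P x| <= C * M ^- p].
Proof.
move=> /andP[p0 pL] Z0.
(* A common constant with |[ell]| <= A/M and |[qq]| <= A/M^2; the summand 1 makes the powers of A
   increasing. *)
pose A : R := 2 * n%:R * Z * K + n%:R * K ^+ 2 + 1.
have A1 : 1 <= A by rewrite lerDr addr_ge0// ?mulr_ge0// exprn_ge0.
have A0 : 0 <= A by exact: le_trans A1.
pose C1 : R := \sum_(b < p) \sum_(c < b.+1) 'C(p, b)%:R * 'C(b, c)%:R * A ^+ p.
have C10 : 0 <= C1.
  by apply: sumr_ge0 => b _; apply: sumr_ge0 => c _; rewrite !mulr_ge0// exprn_ge0.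
exists (2 * (2 * A) ^+ p + C1) => [|M z M1 zZ].
  by rewrite addr_ge0// mulr_ge0// exprn_ge0// mulr_ge0.
have M0 : 0 < M by exact: lt_le_trans M1.
have iM0 : 0 <= M^-1 by rewrite invr_ge0 ltW.
have iM1 : M^-1 <= 1 by rewrite invf_le1.
pose a : R := 1 - sqn z.
pose l (i : 'I_n) : R := 2 * M^-1 * z ord0 i.
pose ell x : R := \sum_(i < n) l i * x ord0 i.
pose qq x : R := - M^-1 ^+ 2 * sqn x.
have Ev x : 1 - sqn (z - M^-1 *: x) = a + (ell x + qq x).
  rewrite /a /ell /qq /sqn mulr_sumr -!addrA; congr (_ + _).
  rewrite -big_split/= -!sumrN -big_split/=; apply: eq_bigr => i _.
  by rewrite !mxE /l; ring.
(* The exponent (b - c) + 2c = b + c is both the degree in x and the order in 1/M: terms with b + c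
   < p are kept, the others are O(M^-p). *)
pose P x : R := \sum_(b < p) \sum_(c < b.+1)
   (if (b + c < p)%N then 'C(p, b)%:R * Num.max 0 a ^+ (p - b) * 'C(b, c)%:R else 0)
   * (ell x ^+ (b - c) * qq x ^+ c).
have mP : mom L P.
  apply: mom_sum => b; apply: mom_sum => c.
  case: ifPn => [bc|_]; last first.
    under eq_fun do rewrite mul0r.
    exact: momW (mom_cst 0).
  apply: momZ; apply: momW (mom_bihom l _ (b - c) c).
  have cb : (c <= b)%N by rewrite -ltnS.
  by rewrite -addnn addnA subnK// (leq_trans (ltnW bc)).
exists P; split; [exact: mP.1|exact: mom_intRn mP|] => x xK.
have sx : sqn x <= n%:R * K ^+ 2.
  rewrite /sqn -[n in n%:R]card_ord -sum1_card natr_sum mulr_suml; apply: ler_sum => i _.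
  rewrite mul1r -real_normK ?num_real// ler_sqr ?nnegrE//.
  exact: le_trans (rv_norm_coord _ _) xK.
have bl : `|ell x| <= A * M^-1.
  apply: le_trans (ler_norm_sum _ _ _) _.
  apply: (@le_trans _ _ (\sum_(i < n) 2 * M^-1 * Z * K)).
    apply: ler_sum => i _; rewrite /l !normrM (ger0_norm iM0) ger0_norm//.
    apply: ler_pM => //; first by rewrite !mulr_ge0.
      rewrite ler_wpM2l ?mulr_ge0//; exact: le_trans (rv_norm_coord _ _) zZ.
    exact: le_trans (rv_norm_coord _ _) xK.
  rewrite sumr_const card_ord -[leLHS]mulr_natl.
  rewrite (_ : n%:R * _ = 2 * n%:R * Z * K * M^-1); last by ring.
  rewrite ler_wpM2r// /A.
  have : 0 <= n%:R * K ^+ 2 by rewrite mulr_ge0// exprn_ge0.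
  by lra.
have bq : `|qq x| <= A * M^-1 ^+ 2.
  rewrite /qq normrM normrN (ger0_norm (sqn_ge0 x)) ger0_norm ?exprn_ge0//.
  rewrite mulrC ler_wpM2r ?exprn_ge0//; apply: le_trans sx _; rewrite /A.
  have : 0 <= 2 * n%:R * Z * K by rewrite !mulr_ge0.
  by lra.
have a1 : Num.max 0 a <= 1 by rewrite ge_max ler01/= gerBl sqn_ge0.
have a0 : 0 <= Num.max 0 a by rewrite le_max lexx.
have bt : `|ell x + qq x| <= 2 * A * M^-1.
  apply: le_trans (ler_normD _ _) _.
  have : A * M^-1 ^+ 2 <= A * M^-1.
    by rewrite ler_wpM2l// expr2 ler_piMl.
  by lra.
rewrite /bumpf Ev mulrDl -(subrKA (\sum_(b < p) 'C(p, b)%:R * Num.max 0 a ^+ (p - b) *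
    (ell x + qq x) ^+ b)); apply: le_trans (ler_normD _ _) _; apply: lerD.
  apply: le_trans (trunc_power_taylor p0 _ _) _.
  rewrite -mulrA ler_wpM2l// -exprVn -exprMn.
  by rewrite lerXn2r// nnegrE ?mulr_ge0.
rewrite /P -sumrB /C1 mulr_suml; apply: le_trans (ler_norm_sum _ _ _) _.
apply: ler_sum => b _.
rewrite exprDn mulr_sumr -sumrB mulr_suml; apply: le_trans (ler_norm_sum _ _ _) _.
apply: ler_sum => c _; have cb : (c <= b)%N by rewrite -ltnS.
case: ifPn => [_|bc].
  rewrite (_ : _ - _ = 0); last by rewrite -mulr_natl; ring.
  by rewrite normr0 !mulr_ge0// ?exprn_ge0// invr_ge0 exprn_ge0// ltW.
rewrite mul0r subr0 -[_ *+ 'C(b, c)]mulr_natl mulrA !normrM !normr_nat !normrX.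
rewrite (ger0_norm a0) -!mulrA ler_wpM2l//.
apply: (@le_trans _ _ ('C(b, c)%:R * (`|ell x| ^+ (b - c) * `|qq x| ^+ c))).
  by rewrite ler_piMl ?exprn_ile1// !mulr_ge0// exprn_ge0.
rewrite ler_wpM2l//.
apply: (@le_trans _ _ ((A * M^-1) ^+ (b - c) * (A * M^-1 ^+ 2) ^+ c)).
  by apply: ler_pM; rewrite ?exprn_ge0// lerXn2r// nnegrE mulr_ge0// exprn_ge0.
rewrite [(A * M^-1) ^+ _]exprMn [(A * _ ^+ 2) ^+ _]exprMn -exprM mulrACA -!exprD subnK// mul2n -addnn addnA subnK//.
apply: ler_pM; rewrite ?exprn_ge0//.
  by apply: ler_weXn2l => //; exact: ltnW.
by rewrite -exprVn ler_wiXn2l// leqNgt.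
Qed.

End Moments.

(** * Smoothing kernels *)

Section Kernel.
Context {R : realType} {n : nat}.
Local Notation pt := 'rV[R]_n.
Implicit Types (K M e d : R) (x u z : pt) (g ps : pt -> R).

Lemma inv_nat_small d : 0 < d ->
  exists Q0, forall Q, (Q0 <= Q)%N -> (0 < Q)%N /\ Q%:R^-1 <= d.
Proof.
move=> d0; exists (Num.truncn d^-1).+1 => Q QQ.
have Q0 : (0 < Q)%N by exact: leq_trans QQ.
split => //; rewrite invf_ple ?posrE ?ltr0n//.
apply: le_trans (ltW (truncnS_gt d^-1)) _.
by rewrite ler_nat.
Qed.

(** Positivity is inherited from a function whose integral is known to be positive: a contracted,
    scaled copy of phi^2 lies below the bump. *)
Lemma bumpf_int_gt0 (p : nat) K (phi : pt -> R) : (0 < p)%N -> 0 <= K -> ccn K phi ->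
  0 < intRn (fun x => phi x ^+ 2) -> 0 < intRn (@bumpf R n p).
Proof.
move=> p0 K0 cphi I0.
have [B B0 phiB] := ccn_bounded cphi.
(* Contracts the support of phi^2 into the region where the bump is at least 2^-p; [c] below lowers
   the height to that level. *)
pose a : R := 2 * n.+1%:R * (K + 1).
have a0 : 0 < a by rewrite !mulr_gt0// ltr_wpDl.
have c2 : ccn K (fun x => phi x ^+ 2).
  by have := ccnMl cphi cphi.1; congr (ccn K _); apply/funext => x; rewrite expr2.
pose c : R := 2^-1 ^+ p / (B + 1) ^+ 2.
have B1 : 0 < (B + 1) ^+ 2 by rewrite exprn_gt0// ltr_wpDl.
have c0 : 0 < c by rewrite divr_gt0// exprn_gt0.
have ca := ccn_affine (0 : pt) (lt0r_neq0 a0) c2.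
pose K' := Num.max 1 ((K + `|0 : pt|) / `|a|).
have K'0 : 0 <= K' by rewrite le_max ler01.
have ca' : ccn K' (fun x => c * phi (a *: x + 0) ^+ 2).
  by apply: ccnZ; apply: ccnW ca; rewrite le_max lexx orbT.
have cb : ccn K' (@bumpf R n p).
  by apply: ccnW (bumpf_ccn p0); rewrite le_max lexx.
apply: (@lt_le_trans _ _ (intRn (fun x => c * phi (a *: x + 0) ^+ 2))).
  rewrite (intRnZ _ K'0 (ccnW _ ca)) ?le_max ?lexx ?orbT//.
  rewrite (@intRn_affine _ _ K (fun x => phi x ^+ 2) a 0 K0 (lt0r_neq0 a0) c2).
  apply: mulr_gt0 => //; apply: mulr_gt0 => //.
  by rewrite invr_gt0 exprn_gt0// gtr0_norm.
apply: (intRn_le K'0 ca' cb) => u; rewrite addr0.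
have [auK|auK] := leP `|a *: u| K; last first.
  by rewrite cphi.2// expr0n mulr0 bumpf_ge0.
apply: le_trans (_ : 2^-1 ^+ p <= _).
  rewrite /c -mulrA ler_piMr ?exprn_ge0// mulrC ler_pdivrMr// mul1r.
  rewrite -real_normK ?num_real// ler_sqr ?nnegrE ?addr_ge0//.
  by apply: le_trans (phiB _) _; rewrite lerDl.
apply: bumpf_ge_half.
move: auK; rewrite normrZ gtr0_norm// => auK.
have n1 : 1 <= n.+1%:R :> R by rewrite ler1n.
have au : 2 * n.+1%:R * `|u| <= 1.
  rewrite -(ler_pM2r (_ : 0 < K + 1)) ?ltr_wpDl// mul1r.
  by apply: le_trans (_ : K <= _); [rewrite mulrAC|rewrite lerDl].
have u1 : `|u| <= 1.
  apply: le_trans au; rewrite ler_peMl//; lra.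
rewrite expr2 mulrA.
apply: (@le_trans _ _ (n.+1%:R * `|u| * 1)).
  by apply: ler_pM; rewrite ?mulr_ge0// ler_wpM2r// ler_nat.
by rewrite mulr1; lra.
Qed.

Lemma grid_weight (p : nat) : (0 < p)%N -> 0 < intRn (@bumpf R n p) ->
  exists Q0, forall Q, (Q0 <= Q)%N -> (0 < Q)%N /\
    intRn (@bumpf R n p) / 2 * Q%:R ^+ n <= \sum_(u <- grid Q n (0 : pt)) bumpf p u.
Proof.
move=> p0; set I := intRn _ => I0.
have cb := @bumpf_ccn R n p p0.
pose D : R := n%:R * 2 ^+ n + 1.
have D0 : 0 < D by rewrite ltr_wpDl// mulr_ge0// exprn_ge0.
have e0 : 0 < I / 2 / D by rewrite !divr_gt0.
have [d d0 dH] := ccn_unifc cb e0.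
have [Q0 HQ] := inv_nat_small d0; exists Q0 => Q /HQ[Qp Qd]; split => //.
have := @grid_riemann _ _ Q _ (I / 2 / D) n 0 Qp cb (leqnn n) (fun x y xy => dH x y (le_trans xy Qd)).
rewrite -mulr_sumr -/(intRn _) -/I; set S := \sum_(u <- _) _ => H.
have : n%:R * 2 ^+ n * (I / 2 / D) <= I / 2.
  rewrite mulrCA ler_piMr ?divr_ge0 ?(ltW I0)// ler_pdivrMr// mul1r.
  by rewrite /D lerDl.
move: H; rewrite ler_norml => /andP[_ H1] H2.
have QQ : 0 < Q%:R ^+ n :> R by rewrite exprn_gt0// ltr0n.
rewrite -ler_pdivlMr// mulrC; lra.
Qed.

Variables (L : nat) (K : R) (ps : pt -> R).
Hypothesis K0 : 0 <= K.
Hypothesis cps : ccn K ps.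
Hypothesis moments : forall a : 'I_n -> nat, (\sum_(i < n) a i <= L)%N ->
  intRn (fun x => (\prod_(i < n) x ord0 i ^+ a i) * ps x) = 0.
Variable p : nat.
Hypothesis pL : (0 < p <= L)%N.

Lemma kernel_eq0 Q M z : 0 <= M -> K + M < `|z| ->
  \sum_(u <- grid Q n 0) bumpf p u * ps (z - M *: u) = 0.
Proof.
move=> M0 KM; rewrite big_seq big1// => u /grid_norm.
rewrite normr0 => /(_ ler01) u1; rewrite cps.2 ?mulr0//.
have := ler_normD (z - M *: u) (M *: u); rewrite subrK normrZ (ger0_norm M0).
have := ler_wpM2l M0 u1; lra.
Qed.

(** Up to the Riemann error, the sum is Q^n times the integral of bump(u) ps(z - M u), that is M^-n
    times the integral of bump((z - x)/M) ps(x). Subtracting the polynomial of [bumpf_taylor]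
    changes nothing and gains M^-p. The threshold on Q may depend on M, but not on z. *)
Lemma kernel_bound : exists2 C : R, 0 <= C & forall M, 1 <= M ->
  exists Q0, forall Q, (Q0 <= Q)%N -> forall z,
    `|\sum_(u <- grid Q n 0) bumpf p u * ps (z - M *: u)| <=
    Q%:R ^+ n * (C * M ^- n * M ^- p).
Proof.
have p0 : (0 < p)%N by case/andP: pL.
(* The radius 1 + K suffices: the sum vanishes unless |z| <= K + M, and then |z/M| <= 1 + K. *)
have [C C0 HC] := bumpf_taylor K0 cps moments pL (addr_ge0 ler01 K0).
have [B B0 psB] := ccn_bounded cps.
exists ((2 * K) ^+ n * (C * B) + 1) => [|M M1].
  by rewrite addr_ge0// mulr_ge0 ?exprn_ge0 ?mulr_ge0.
have M0 : 0 < M by exact: lt_le_trans M1.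
(* Tolerance for which the error in [grid_riemann] is at most M^-n M^-p. *)
pose e : R := M ^- n * M ^- p / (n%:R * 2 ^+ n + 1).
have D0 : 0 < n%:R * 2 ^+ n + 1 :> R by rewrite ltr_wpDl// mulr_ge0// exprn_ge0.
have Mnp : 0 < M ^- n * M ^- p by rewrite mulr_gt0// invr_gt0 exprn_gt0.
have e0 : 0 < e by rewrite divr_gt0.
have cb := @bumpf_ccn R n p p0.
have B1 : 0 < B + 1 by rewrite ltr_wpDl.
have e1 : 0 < e / 2 / (B + 1) by apply: divr_gt0 => //; exact: divr_gt0.
have [d1 d10 dH1] := ccn_unifc cb e1.
have [d2 d20 dH2] := ccn_unifc cps (divr_gt0 e0 (ltr0n _ 2)).
have dd : 0 < Num.min d1 (d2 / M) by rewrite lt_min d10 divr_gt0.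
have [Q0 HQ] := inv_nat_small dd; exists Q0 => Q /HQ[Qp Qd] z.
have QQ : 0 < Q%:R ^+ n :> R by rewrite exprn_gt0// ltr0n.
have [zKM|zKM] := leP `|z| (K + M); last first.
  rewrite kernel_eq0 ?(ltW M0)// normr0 !mulr_ge0 ?(ltW QQ)// ?invr_ge0 ?exprn_ge0 ?(ltW M0)//.
  by rewrite addr_ge0// mulr_ge0 ?exprn_ge0 ?mulr_ge0.
pose G u := bumpf p u * ps (z - M *: u).
have cG : ccn 1 G.
  apply: ccnMr => //; have := @rv_caff _ _ ps (- M) z cps.1.
  by under eq_fun do rewrite scaleNr addrC.
have mG x y : `|x - y| <= Q%:R^-1 -> `|G x - G y| <= e.
  move=> xy; move: Qd; rewrite le_min => /andP[Q1 Q2].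
  have h1 := dH1 x y (le_trans xy Q1).
  have h2 : `|ps (z - M *: x) - ps (z - M *: y)| <= e / 2.
    apply: dH2; rewrite opprB addrC addrA subrK -scalerBr normrZ distrC gtr0_norm//.
    by have := le_trans xy Q2; rewrite ler_pdivlMr// mulrC.
  rewrite (_ : G x - G y = (bumpf p x - bumpf p y) * ps (z - M *: x) +
     bumpf p y * (ps (z - M *: x) - ps (z - M *: y))); last by rewrite /G; ring.
  apply: le_trans (ler_normD _ _) _; rewrite !normrM.
  have t1 : `|bumpf p x - bumpf p y| * `|ps (z - M *: x)| <= e / 2.
    apply: le_trans (_ : e / 2 / (B + 1) * (B + 1) <= _).
      by apply: ler_pM => //; apply: le_trans (psB _) _; rewrite lerDl.
    by rewrite divfK// gt_eqF// ltr_wpDl.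
  have t2 : `|bumpf p y| * `|ps (z - M *: x) - ps (z - M *: y)| <= e / 2.
    apply: le_trans h2; rewrite ler_piMl// ger0_norm ?bumpf_ge0//.
    exact: bumpf_le1.
  by have := lerD t1 t2; lra.
have := @grid_riemann _ _ Q G e n 0 Qp cG (leqnn n) mG.
rewrite -mulr_sumr -/(intRn _); set S := \sum_(u <- _) _ => H1.
have H2 : n%:R * 2 ^+ n * e <= M ^- n * M ^- p.
  rewrite /e mulrCA ler_piMr ?(ltW Mnp)// ler_pdivrMr// mul1r.
  by rewrite lerDl.
have [|P [cP P0 PH]] := HC M (M^-1 *: z) M1.
  rewrite normrZ ger0_norm ?invr_ge0 ?(ltW M0)// mulrC ler_pdivrMr//.
  apply: le_trans zKM _; rewrite mulrDl mul1r addrC lerD2l.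
  by rewrite ler_peMr.
pose H x := bumpf p (M^-1 *: z - M^-1 *: x) * ps x.
have cH : ccn K H.
  apply: ccnMl => //.
  have := @rv_caff _ _ (bumpf p) (- M^-1) (M^-1 *: z) cb.1.
  by under eq_fun do rewrite scaleNr addrC.
have EG : G = (fun u => H (- M *: u + z)).
  apply/funext => u; rewrite /G /H; congr (bumpf p _ * ps _).
    rewrite scalerDr opprD addrCA subrr addr0 scaleNr scalerN opprK scalerA.
    by rewrite mulVf ?gt_eqF// scale1r.
  by rewrite scaleNr addrC.
have IG : intRn G = M ^- n * intRn H.
  rewrite EG (intRn_affine _ K0 _ cH) ?oppr_eq0 ?gt_eqF//.
  by rewrite normrN gtr0_norm.
have cP' : ccn K (fun x => P x * ps x) by exact: ccnMl.
have IH : `|intRn H| <= (2 * K) ^+ n * (C * B) * M ^- p.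
  rewrite -[intRn H]subr0 -P0 -(intRnB K0 cH cP') -mulrA.
  apply: intRn_bound => //.
    by apply: ccnD => //; exact: ccnN.
  move=> x; rewrite /H -mulrBl normrM.
  have [xK|xK] := leP `|x| K; last first.
    by rewrite cps.2// normr0 mulr0 !mulr_ge0// invr_ge0 exprn_ge0// ltW.
  by rewrite mulrAC; apply: ler_pM => //; exact: PH.
have IG' : `|intRn G| <= M ^- n * ((2 * K) ^+ n * (C * B) * M ^- p).
  rewrite IG normrM ger0_norm ?invr_ge0 ?exprn_ge0 ?(ltW M0)//.
  by rewrite ler_wpM2l// invr_ge0 exprn_ge0 ?(ltW M0).
have HS : `|Q%:R ^- n * S| <= M ^- n * ((2 * K) ^+ n * (C * B) * M ^- p) + M ^- n * M ^- p.
  rewrite -[Q%:R ^- n * S](subKr (intRn G)); apply: le_trans (ler_normB _ _) _.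
  by apply: lerD => //; exact: le_trans H2.
move: HS; rewrite normrM ger0_norm ?invr_ge0 ?(ltW QQ)// mulrC ler_pdivrMr// => HS.
apply: le_trans HS _; rewrite mulrC ler_wpM2l ?(ltW QQ)//.
by rewrite le_eqVlt; apply/orP; left; apply/eqP; ring.
Qed.

End Kernel.

(** * Averaging operators *)

Section Averages.
Context {R : realType} {n : nat}.
Local Notation pt := 'rV[R]_n.
Implicit Types (d e G : R) (x u v : pt) (g : pt -> R) (S : seq (R * pt)).

Definition dop S d g x : R := \sum_(j <- S) j.1 * g (x + d *: j.2).

Lemma dop_comm S d e g : dop S d (dop S e g) = dop S e (dop S d g).
Proof.
apply/funext => x; rewrite /dop.
under eq_bigr do rewrite mulr_sumr.
under [RHS]eq_bigr do rewrite mulr_sumr.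
rewrite exchange_big/=; apply: eq_bigr => i _; apply: eq_bigr => j _.
by rewrite mulrCA addrAC.
Qed.

Lemma dopB S d g g' :
  dop S d (fun x => g x - g' x) = (fun x => dop S d g x - dop S d g' x).
Proof.
by apply/funext => x; rewrite /dop -sumrB; apply: eq_bigr => j _; rewrite mulrBr.
Qed.

Lemma dop_norm_le S d g G N : \sum_(j <- S) `|j.1| <= N -> 0 <= G ->
  (forall x, `|g x| <= G) -> forall x, `|dop S d g x| <= N * G.
Proof.
move=> SN G0 gG x; apply: le_trans (ler_norm_sum _ _ _) _.
apply: le_trans (ler_wpM2r G0 SN); rewrite mulr_suml; apply: ler_sum => j _.
by rewrite normrM ler_wpM2l.
Qed.

Lemma dop_continuous S d g : continuous g -> continuous (dop S d g).
Proof. by move=> cg; apply: rv_csum => j; apply: rv_cZ; exact: rv_ctrans. Qed.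

(* [avg_coef k p T] lists the coefficients and shifts of the operator
   sum_(1 <= m <= k) (-1)^(m-1) C(k, m) <g(x + m u)>_u, where <.>_u is the
   [bumpf p]-weighted mean over the grid T; subtracting it from g leaves the
   mean of the k-th forward difference of g. *)
Definition avg_coef (k p : nat) (T : seq pt) : seq (R * pt) :=
  [seq ((-1) ^+ m * 'C(k, m.+1)%:R * (bumpf p u / \sum_(v <- T) bumpf p v),
        m.+1%:R *: u) | m <- index_iota 0 k, u <- T].

Lemma big_avg_coef k p T (F : R * pt -> R) :
  \sum_(j <- avg_coef k p T) F j = \sum_(m < k) \sum_(u <- T)
   F ((-1) ^+ m * 'C(k, m.+1)%:R * (bumpf p u / \sum_(v <- T) bumpf p v), m.+1%:R *: u).
Proof. by rewrite big_allpairs_dep big_mkord. Qed.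

Lemma bumpf_mean1 p (T : seq pt) : 0 < \sum_(v <- T) bumpf p v ->
  \sum_(u <- T) (bumpf p u / \sum_(v <- T) bumpf p v) = 1.
Proof. by move=> W0; rewrite -mulr_suml divff// gt_eqF. Qed.

Lemma avg_coef_norm k p T : 0 < \sum_(v <- T) bumpf p v ->
  \sum_(j <- avg_coef k p T) `|j.1| <= \sum_(m < k) 'C(k, m.+1)%:R.
Proof.
move=> W0; rewrite big_avg_coef; apply: ler_sum => m _ /=.
under eq_bigr => u _ do rewrite !normrM normrX normrN1 expr1n mul1r normr_nat
  (ger0_norm (bumpf_ge0 p u)) ger0_norm ?invr_ge0 ?(ltW W0)//.
by rewrite -mulr_sumr bumpf_mean1// mulr1.
Qed.

Lemma dop_avg_approx k p T d g e : 0 < \sum_(v <- T) bumpf p v ->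
  (forall u x, u \in T -> `|sdiffn k (d *: u) g x| <= e) ->
  forall x, `|g x - dop (avg_coef k p T) d g x| <= e.
Proof.
move=> W0 He x; set W := \sum_(v <- T) _ in W0.
have -> : g x - dop (avg_coef k p T) d g x =
  \sum_(u <- T) bumpf p u / W *
    ((-1) ^+ k * sdiffn k (d *: u) g (x + (k%:R / 2) *: (d *: u))).
  have {1}-> : g x = \sum_(u <- T) bumpf p u / W * g x.
    by rewrite -mulr_suml (bumpf_mean1 W0) mul1r.
  rewrite /dop big_avg_coef exchange_big/=.
  rewrite -sumrB; apply: eq_bigr => u _. rewrite sdiffn_forward.
  rewrite mulr_sumr big_ord_recl/= scale0r addr0 bin0 subn0 mulr1 mulrA.
  rewrite -exprD -signr_odd oddD addbb expr0 mul1r mulrDr -/W; congr (_ + _).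
  rewrite mulr_sumr -sumrN; apply: eq_bigr => m _.
  rewrite /fintype.bump/= add1n !scalerA [m.+1%:R * d]mulrC.
  have -> : (-1) ^+ k * ((-1) ^+ (k - m.+1) * 'C(k, m.+1)%:R * g (x + (d * m.+1%:R) *: u))
    = - ((-1) ^+ m * 'C(k, m.+1)%:R * g (x + (d * m.+1%:R) *: u)).
    have mk : (m.+1 <= k)%N by [].
    (* The exponents add up to 2k - (m + 1), which has the parity of m + 1. *)
    have S : (-1) ^+ k * (-1) ^+ (k - m.+1) = - (-1) ^+ m :> R.
      by rewrite -exprD -signr_odd oddD oddB// addbA addbb addFb signr_odd exprS mulN1r.
    by rewrite !mulrA S; ring.
  by ring.
apply: le_trans (ler_norm_sum _ _ _) _.
apply: (@le_trans _ _ (\sum_(u <- T) bumpf p u / W * e)); last first.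
  by rewrite -mulr_suml (bumpf_mean1 W0) mul1r.
rewrite big_seq [leRHS]big_seq; apply: ler_sum => u uT.
rewrite !normrM [`|(-1) ^+ k|]normrX normrN1 expr1n mul1r (ger0_norm (bumpf_ge0 p u)).
rewrite ger0_norm ?invr_ge0 ?(ltW W0)// ler_wpM2l ?divr_ge0 ?bumpf_ge0 ?(ltW W0)//.
exact: He.
Qed.

Variables (L : nat) (K : R) (ps : pt -> R).
Hypothesis K0 : 0 <= K.
Hypothesis cps : ccn K ps.
Hypothesis moments : forall a : 'I_n -> nat, (\sum_(i < n) a i <= L)%N ->
  intRn (fun x => (\prod_(i < n) x ord0 i ^+ a i) * ps x) = 0.
Variable p : nat.
Hypothesis pL : (0 < p <= L)%N.
Hypothesis I0 : 0 < intRn (@bumpf R n p).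

(** Translation invariance moves the average onto [ps], giving for each m the kernel of
    [kernel_bound] at M = (m + 1) d. Its support has volume O(M^n), which cancels M^-n, and the
    total weight of the grid cancels Q^n, so that d^-p remains. *)
Lemma dop_smoothing (k : nat) : exists2 C : R, 0 <= C & forall d, 1 <= d ->
  exists Q0, forall Q, (Q0 <= Q)%N ->
    0 < \sum_(u <- grid Q n (0 : pt)) bumpf p u /\
    forall g G, continuous g -> (forall x, `|g x| <= G) ->
    `|intRn (fun x => dop (avg_coef k p (grid Q n 0)) d g x * ps x)| <= C * G * d ^- p.
Proof.
have p0 : (0 < p)%N by case/andP: pL.
have [C C0 HC] := kernel_bound K0 cps moments pL.
have [Q1 HQ1] := grid_weight p0 I0.
set I := intRn (@bumpf R n p) in HQ1 *; have I_gt0 : 0 < I by exact: I0.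
pose C' : R := (2 * (K + 1)) ^+ n * (C / (I / 2)).
have C'0 : 0 <= C'.
  apply: mulr_ge0; first by rewrite exprn_ge0// mulr_ge0// addr_ge0.
  by rewrite divr_ge0// divr_ge0// ltW.
exists (\sum_(m < k) 'C(k, m.+1)%:R * C'); first by apply: sumr_ge0 => m _; rewrite mulr_ge0.
move=> d d1; have d0 : 0 < d by exact: lt_le_trans d1.
have M1 (m : 'I_k) : 1 <= m.+1%:R * d :> R.
  by rewrite -[leLHS]mulr1; apply: ler_pM => //; rewrite ler1n.
pose Q2 (m : 'I_k) := sval (cid (HC _ (M1 m))).
have HQ2 (m : 'I_k) := svalP (cid (HC _ (M1 m))).
exists (maxn Q1 (\max_(m < k) Q2 m)) => Q; rewrite geq_max => /andP[QQ1 QQ2].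
have [Qp HW] := HQ1 Q QQ1.
have QQ : 0 < Q%:R ^+ n :> R by rewrite exprn_gt0// ltr0n.
set T := grid Q n 0 in HW *; set W := \sum_(u <- T) _ in HW *.
have W0 : 0 < W by apply: lt_le_trans HW; rewrite mulr_gt0// divr_gt0.
split => // g G cg gG.
have G0 : 0 <= G by apply: le_trans (gG 0).
pose M (m : 'I_k) : R := m.+1%:R * d.
pose ker (m : 'I_k) z := \sum_(u <- T) bumpf p u * ps (z - M m *: u).
have cker m : ccn (K + M m) (ker m).
  have M0 : 0 <= M m by exact: le_trans (M1 m).
  split; last by move=> z; exact: kernel_eq0.
  by apply: rv_csum => u; apply: rv_cZ; apply: rv_ctrans; exact: cps.1.
have -> : intRn (fun x => dop (avg_coef k p T) d g x * ps x) =
    \sum_(m < k) (-1) ^+ m * 'C(k, m.+1)%:R / W * intRn (fun z => g z * ker m z).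
  have cc v : ccn K (fun x => g (x + v) * ps x) by apply: ccnMl => //; exact: rv_ctrans.
  pose c (m : 'I_k) u := (-1) ^+ m * 'C(k, m.+1)%:R * (bumpf p u / W).
  transitivity (\sum_(m < k) \sum_(u <- T) intRn (fun x => c m u * (g (x + M m *: u) * ps x))).
    rewrite (_ : (fun x => _) = (fun x => \sum_(m < k) \sum_(u <- T)
       c m u * (g (x + M m *: u) * ps x))); last first.
      apply/funext => x; rewrite /dop big_avg_coef mulr_suml; apply: eq_bigr => m _.
      rewrite mulr_suml; apply: eq_bigr => u _ /=.
      by rewrite -mulrA scalerA /M [d * _]mulrC.
    rewrite (@intRn_sum _ _ _ _ _ K)//; last first.
      by move=> m; apply: ccn_sum => u; exact: ccnZ.
    apply: eq_bigr => m _; rewrite (@intRn_sum _ _ _ _ _ K)// => u.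
    exact: ccnZ.
  apply: eq_bigr => m _.
  have M0 : 0 <= M m by exact: le_trans (M1 m).
  have ccu u : ccn (K + `|M m *: u|) (fun z => g z * ps (z - M m *: u)).
    by apply: ccnMl => //; have := ccn_trans (- (M m *: u)) cps; rewrite normrN.
  have E u : intRn (fun x => c m u * (g (x + M m *: u) * ps x)) =
      (-1) ^+ m * 'C(k, m.+1)%:R / W * (bumpf p u * intRn (fun z => g z * ps (z - M m *: u))).
    rewrite (intRnZ _ K0 (cc _)).
    rewrite -(@intRn_trans _ _ _ _ (M m *: u) _ (ccu u)) ?addr_ge0//.
    rewrite (_ : (fun x : pt => g (x + _) * ps (x + _ - _)) = (fun x => g (x + M m *: u) * ps x)).
      by rewrite /c; ring.
    by apply/funext => x; rewrite addrK.
  under eq_bigr do rewrite E.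
  rewrite -mulr_sumr; congr (_ * _).
  have cc2 u : u \in T -> ccn (K + M m) (fun z => bumpf p u * (g z * ps (z - M m *: u))).
    move=> /grid_norm; rewrite normr0 => /(_ ler01) u1; apply: ccnZ; apply: ccnW (ccu u).
    by rewrite lerD2l normrZ (ger0_norm M0) ler_piMr.
  (* [intRn_sum] asks for one support radius for all indices; only grid points have norm at most 1,
     so the other indices are sent to 0. *)
  pose F u := if u \in T then (fun z => bumpf p u * (g z * ps (z - M m *: u))) else (fun=> 0).
  have cF u : ccn (K + M m) (F u) by rewrite /F; case: ifP => [/cc2//|_]; exact: ccn0.
  rewrite (_ : (fun z => _) = (fun z => \sum_(u <- T) F u z)); last first.
    apply/funext => z; rewrite /ker mulr_sumr big_seq [RHS]big_seq; apply: eq_bigr => u uT.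
    by rewrite /F uT mulrCA.
  rewrite (intRn_sum _ _ cF) ?addr_ge0// big_seq [RHS]big_seq; apply: eq_bigr => u uT.
  by rewrite /F uT (intRnZ _ _ (ccu u))// addr_ge0.
apply: le_trans (ler_norm_sum _ _ _) _.
rewrite !mulr_suml; apply: ler_sum => m _.
have M0 : 0 < M m by exact: lt_le_trans (M1 m).
have kb z : `|ker m z| <= Q%:R ^+ n * (C * M m ^- n * M m ^- p).
  by apply: HQ2; apply: leq_trans QQ2; exact: (@leq_bigmax _ Q2 m).
rewrite !normrM normrX normrN1 expr1n mul1r normr_nat ger0_norm ?invr_ge0 ?(ltW W0)//.
rewrite -!mulrA ler_wpM2l//.
have IB : `|intRn (fun z => g z * ker m z)| <=
    (2 * (K + M m)) ^+ n * (G * (Q%:R ^+ n * (C * M m ^- n * M m ^- p))).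
  apply: intRn_bound; first by rewrite addr_ge0// ltW.
    exact: ccnMl.
  by move=> z; rewrite normrM; apply: ler_pM.
have KM : (2 * (K + M m)) ^+ n <= (2 * (K + 1)) ^+ n * M m ^+ n.
  have KM1 : K <= K * M m by rewrite ler_peMr//; exact: M1.
  rewrite -exprMn; apply: lerXn2r; rewrite ?nnegrE.
  - by rewrite mulr_ge0// addr_ge0// ltW.
  - by rewrite !mulr_ge0 ?addr_ge0// ltW.
  - by rewrite -mulrA ler_wpM2l// mulrDl mul1r lerD2r.
have Wi : W^-1 <= (I / 2 * Q%:R ^+ n)^-1.
  by rewrite lef_pV2 ?posrE// mulr_gt0// divr_gt0.
have dp : M m ^- p <= d ^- p.
  rewrite lef_pV2 ?posrE ?exprn_gt0// lerXn2r ?nnegrE ?(ltW d0) ?(ltW M0)//.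
  by rewrite ler_peMl ?(ltW d0)// ler1n.
have Mn0 : 0 < M m ^+ n by rewrite exprn_gt0.
have Mp0 : 0 <= M m ^- p by rewrite invr_ge0 exprn_ge0// ltW.
have X0 : 0 <= C * M m ^- n * M m ^- p by rewrite !mulr_ge0 // invr_ge0 ltW.
apply: le_trans (_ : (I / 2 * Q%:R ^+ n)^-1 *
   ((2 * (K + 1)) ^+ n * M m ^+ n * (G * (Q%:R ^+ n * (C * M m ^- n * M m ^- p)))) <= _).
  apply: ler_pM => //; first by rewrite invr_ge0 ltW.
  apply: le_trans IB _; apply: ler_wpM2r => //.
  by rewrite mulr_ge0// mulr_ge0// ltW.
rewrite [leLHS](_ : _ = C' * G * M m ^- p).
  apply: le_trans (_ : C' * G * d ^- p <= _); last by rewrite /C' -!mulrA.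
  by rewrite ler_wpM2l// mulr_ge0.
have fracE (a b c q y z w : R) : a != 0 -> q != 0 -> y != 0 ->
    (a / 2 * q)^-1 * (b * y * (c * (q * (z * y^-1 * w)))) = b * (z / (a / 2)) * c * w.
  by move=> a0 q0 y0; field; rewrite a0 q0 y0.
by apply: fracE; rewrite gt_eqF.
Qed.

End Averages.

(** * Decay of the coefficients *)

Section CoefficientDecay.
Context {R : realType} {n : nat}.
Local Notation pt := 'rV[R]_n.
Implicit Types (x h : pt) (g : pt -> R).

Lemma geo_sum_le (th : R) (i : nat) : 0 <= th -> th < 1 ->
  \sum_(t < i) th ^+ t <= (1 - th)^-1.
Proof.
move=> th0 th1; have t1 : 0 < 1 - th by rewrite subr_gt0.
rewrite -[leRHS]mul1r ler_pdivlMr// mulrC.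
have := subrX1 th i; rewrite -opprB -[th - 1]opprB mulNr => /oppr_inj <-.
by rewrite gerBl exprn_ge0.
Qed.

Lemma sum_telescope (f : nat -> R) i :
  \sum_(t < i) (f t - f t.+1) = f 0%N - f i.
Proof.
elim: i => [|i IH]; first by rewrite big_ord0 subrr.
by rewrite big_ord_recr/= IH; ring.
Qed.

Variables (L : nat) (K : R) (ps : pt -> R).
Hypothesis K0 : 0 <= K.
Hypothesis cps : ccn K ps.
Hypothesis moments : forall a : 'I_n -> nat, (\sum_(i < n) a i <= L)%N ->
  intRn (fun x => (\prod_(i < n) x ord0 i ^+ a i) * ps x) = 0.
Variable p : nat.
Hypothesis pL : (0 < p <= L)%N.
Hypothesis I0 : 0 < intRn (@bumpf R n p).

(** The number i of levels is free and C depends neither on it nor on the grid. In the application g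
    is f rescaled from scale 2^-i, so that D and sg^-i are both of order 2^(-is). *)
Lemma pairing_decay (k : nat) (sg : R) : 1 <= sg -> sg < 2 ^+ p ->
  exists2 C : R, 0 <= C & forall g (G D : R) (i : nat), continuous g ->
    (forall x, `|g x| <= G) -> 0 <= D ->
    (forall (t : nat) h x, `|h| <= 2 ^+ t -> `|sdiffn k h g x| <= D * sg ^+ t) ->
    `|intRn (fun x => g x * ps x)| <= C * (D + G * sg ^- i).
Proof.
move=> sg1 sgp.
have [C1 C10 HC1] := dop_smoothing K0 cps moments pL I0 k.
have [B B0 psB] := ccn_bounded cps.
pose N : R := \sum_(m < k) 'C(k, m.+1)%:R.
have N0 : 0 <= N by apply: sumr_ge0.
have sg0 : 0 < sg by exact: lt_le_trans sg1.
have p2 : 0 < 2 ^+ p :> R by rewrite exprn_gt0.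
(* Ratio of successive telescope terms: differences grow by sg per level while averaging gains
   2^-p. *)
pose th := sg / 2 ^+ p.
have th0 : 0 <= th by rewrite divr_ge0// ltW.
have th1 : th < 1 by rewrite ltr_pdivrMr// mul1r.
have ith : 0 <= (1 - th)^-1 by rewrite invr_ge0 subr_ge0 ltW.
pose c1 := (2 * K) ^+ n * ((1 + N) * B).
pose c2 := 4 * C1 * sg * (1 - th)^-1.
pose c3 := C1 * N.
have c10 : 0 <= c1 by rewrite mulr_ge0 ?exprn_ge0 ?mulr_ge0// addr_ge0.
have c20 : 0 <= c2 by rewrite !mulr_ge0// ltW.
have c30 : 0 <= c3 by rewrite mulr_ge0.
exists (c1 + c2 + c3) => [|g G D i cg gG D0 Hg]; first by rewrite !addr_ge0.
have G0 : 0 <= G by apply: le_trans (gG 0).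
have two1 (t : nat) : 1 <= 2 ^+ t :> R by apply: exprn_ege1; rewrite ler1n.
pose Q0 (t : nat) := sval (cid (HC1 _ (two1 t))).
have HQ (t : nat) := svalP (cid (HC1 _ (two1 t))).
(* Only finitely many levels occur, so one grid is fine enough for all of them, and the averages
   commute. *)
pose Q := \max_(t < i.+1) Q0 t.
have QQ t : (t <= i)%N -> (Q0 t <= Q)%N.
  by move=> ti; exact: (@leq_bigmax _ (fun t : 'I_i.+1 => Q0 t) (Ordinal (ti : (t < i.+1)%N))).
have [W0 _] := HQ 0%N Q (QQ 0%N (leq0n _)).
pose S := avg_coef k p (grid Q n (0 : pt)).
pose A (t : nat) g' := dop S (2 ^+ t) g'.
have cA t g' : continuous g' -> continuous (A t g') by exact: dop_continuous.
have SN : \sum_(j <- S) `|j.1| <= N by exact: avg_coef_norm.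
have bA t g' G' : 0 <= G' -> (forall x, `|g' x| <= G') -> forall x, `|A t g' x| <= N * G'.
  by move=> G'0; exact: dop_norm_le.
have apx (t : nat) x : `|g x - A t g x| <= D * sg ^+ t.
  apply: dop_avg_approx => // u y /grid_norm; rewrite normr0 => /(_ ler01) u1.
  by apply: Hg; rewrite normrZ ger0_norm ?exprn_ge0// ler_piMr// exprn_ge0.
have smo (t : nat) g' G' : (t <= i)%N -> continuous g' -> (forall x, `|g' x| <= G') ->
    `|intRn (fun x => A t g' x * ps x)| <= C1 * G' * (2 ^+ t) ^- p.
  by move=> ti; apply: (HQ t Q (QQ t ti)).2.
pose F (t : nat) := A t (A t g).
have cF t : continuous (F t) by exact: cA (cA _ _ cg).
pose J (g' : pt -> R) := intRn (fun x => g' x * ps x).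
have JB g1 g2 : continuous g1 -> continuous g2 ->
    J (fun x => g1 x - g2 x) = J g1 - J g2.
  move=> c c'; rewrite /J -(intRnB K0 (ccnMl cps c) (ccnMl cps c')).
  by congr intRn; apply/funext => x; rewrite mulrBl.
have JD g1 g2 : continuous g1 -> continuous g2 ->
    J (fun x => g1 x + g2 x) = J g1 + J g2.
  move=> c c'; rewrite /J -(intRnD K0 (ccnMl cps c) (ccnMl cps c')).
  by congr intRn; apply/funext => x; rewrite mulrDl.
have h1 : `|J g - J (F 0%N)| <= c1 * D.
  rewrite -JB// /J /c1 -mulrA; apply: intRn_bound => //.
    by apply: ccnMl => //; apply: rv_cD => //; exact: rv_cN.
  move=> x; rewrite normrM mulrAC; apply: ler_pM => //.
  (* 1 - A_0 A_0 = (1 - A_0) + A_0 (1 - A_0), and A_0 is bounded by N. *)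
  rewrite (_ : g x - _ = (g x - A 0%N g x) + A 0%N (fun x => g x - A 0%N g x) x); last first.
    by rewrite /A dopB /F /A addrA subrK.
  apply: le_trans (ler_normD _ _) _; rewrite mulrDl mul1r.
  have apx0 y : `|g y - A 0%N g y| <= D by have := apx 0%N y; rewrite expr0 mulr1.
  by apply: lerD => //; exact: bA.
have h2 (t : nat) : (t < i)%N -> `|J (F t) - J (F t.+1)| <= 4 * C1 * sg * D * th ^+ t.
  move=> ti; pose gt x := A t g x - A t.+1 g x.
  have cgt : continuous gt.
    by apply: rv_cD; [exact: cA|apply: rv_cN; exact: cA].
  have bgt x : `|gt x| <= 2 * D * sg ^+ t.+1.
    rewrite /gt (_ : A t g x - A t.+1 g x = (g x - A t.+1 g x) - (g x - A t g x)); last by ring.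
    apply: le_trans (ler_normB _ _) _.
    have : D * sg ^+ t <= D * sg ^+ t.+1 by rewrite ler_wpM2l// ler_weXn2l.
    have := apx t x; have := apx t.+1 x; lra.
  rewrite -JB// (_ : (fun x => F t x - F t.+1 x) = (fun x => A t gt x + A t.+1 gt x)); last first.
    apply/funext => x; rewrite /F /A /gt !dopB (dop_comm S (2 ^+ t.+1) (2 ^+ t)).
    by rewrite addrA subrK.
  rewrite JD; [|exact: cA..].
  apply: le_trans (ler_normD _ _) _.
  have b1 := smo t gt _ (ltnW ti) cgt bgt.
  have b2 := smo t.+1 gt _ ti cgt bgt.
  have tp : (2 ^+ t.+1) ^- p <= (2 ^+ t) ^- p :> R.
    rewrite lef_pV2 ?posrE ?exprn_gt0//.
    by rewrite lerXn2r ?nnegrE ?exprn_ge0// ler_weXn2l// ler1n.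
  have X0 : 0 <= C1 * (2 * D * sg ^+ t.+1) by rewrite !mulr_ge0// exprn_ge0// ltW.
  have b3 := ler_wpM2l X0 tp.
  have -> : 4 * C1 * sg * D * th ^+ t = 2 * (C1 * (2 * D * sg ^+ t.+1) * (2 ^+ t) ^- p).
    rewrite /th expr_div_n exprS -!exprM mulnC; field.
    by rewrite expf_neq0.
  move: b1 b2 b3; rewrite /J; lra.
(* At the last level only the boundedness of g enters, together with 2^-p <= 1/sg. *)
have h3 : `|J (F i)| <= c3 * (G * sg ^- i).
  have := smo i (A i g) _ (leqnn i) (cA i _ cg) (bA i g G G0 gG).
  move=> /le_trans; apply; rewrite /c3 -!mulrA.
  rewrite !ler_wpM2l// lef_pV2 ?posrE ?exprn_gt0//.
  by rewrite -exprM mulnC exprM lerXn2r ?nnegrE ?exprn_ge0// ltW.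
have tele : J g = (J g - J (F 0%N)) + (\sum_(t < i) (J (F t) - J (F t.+1))) + J (F i).
  have -> : \sum_(t < i) (J (F t) - J (F t.+1)) = J (F 0%N) - J (F i).
    exact: (sum_telescope (fun t => J (F t))).
  by ring.
rewrite -/(J g) tele.
apply: le_trans (ler_normD _ _) _; apply: le_trans (lerD (ler_normD _ _) (lexx _)) _.
have hs : `|\sum_(t < i) (J (F t) - J (F t.+1))| <= c2 * D.
  apply: le_trans (ler_norm_sum _ _ _) _.
  apply: (@le_trans _ _ (\sum_(t < i) 4 * C1 * sg * D * th ^+ t)).
    by apply: ler_sum => t _; exact: h2.
  rewrite -mulr_sumr /c2 [leRHS]mulrAC ler_wpM2l ?mulr_ge0// ?(ltW sg0)//.
  exact: geo_sum_le.
have s0 : 0 <= G * sg ^- i by rewrite mulr_ge0// invr_ge0 exprn_ge0// ltW.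
have := mulr_ge0 c10 s0; have := mulr_ge0 c20 s0; have := mulr_ge0 c30 D0.
rewrite !mulrDl !mulrDr; lra.
Qed.

End CoefficientDecay.

(** * Differences of functions in Lambda_s *)

Section HolderZygmund.
Context {R : realType} {n : nat}.
Local Notation pt := 'rV[R]_n.
Implicit Types (x h : pt) (f : pt -> R).

Lemma powR_expn (a s : R) (t : nat) : 0 <= a -> (a ^+ t) `^ s = (a `^ s) ^+ t.
Proof. by move=> a0; rewrite -!powR_mulrn ?powR_ge0// -!powRrM mulrC. Qed.

Lemma powRVx (a s : R) : 0 < a -> a^-1 `^ s = (a `^ s)^-1.
Proof.
by move=> a0; rewrite -powR_inv1 ?(ltW a0)// -powRrM mulN1r powRN.
Qed.

Lemma sdiffn0 r f x : sdiffn r.+1 (0 : pt) f x = 0.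
Proof. by rewrite sdiffnS scaler0 addr0 subr0 subrr. Qed.

(** Boundedness of f makes the supremum genuine; [sup] of an unbounded set is 0. *)
Lemma DeltaR_ub r f x h M : (forall x, `|f x| <= M) ->
  `|sdiffn r h f x| <= DeltaR r f x (enorm h).
Proof.
move=> fM; apply: ub_le_sup; last by exists h.
by exists (2 ^+ r * M) => _ [h' _ <-]; exact: sdiffn_norm_le.
Qed.

Lemma DeltaR_gt r f x (y e : R) : 0 <= e -> e < DeltaR r f x y ->
  exists2 h, enorm h = y & e < `|sdiffn r h f x|.
Proof.
move=> e0 eD.
(* Without a supremum [sup] is 0, which cannot exceed e >= 0. *)
have [hs|/sup_out D0] := pselect (has_sup [set `|sdiffn r h f x| | h in [set h : pt | enorm h = y]]).
  have de : 0 < DeltaR r f x y - e by rewrite subr_gt0.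
  have [_ [h /= hy <-] eh] := sup_adherent de hs.
  by exists h => //; move: eh; rewrite /DeltaR subKr.
by move: eD; rewrite /DeltaR D0 ltNge e0.
Qed.

(** Steps longer than 1 are covered by the boundedness of f, since then |h|^s >= 1. They are
    required because [pairing_decay] asks for arbitrarily large steps. *)
Lemma Lambda_sdiffn s f : 0 < s -> in_Lambda s f ->
  exists2 C : R, 0 <= C &
    forall h x, `|sdiffn (Num.truncn s).+1 h f x| <= C * enorm h `^ s.
Proof.
move=> s0 [_ [[M fM] [C HC]]].
have M0 : 0 <= M by apply: le_trans (fM 0).
set k := (Num.truncn s).+1 in HC *.
have MM : 0 <= 2 ^+ k * M by rewrite mulr_ge0// exprn_ge0.
exists (`|C| + 2 ^+ k * M) => [|h x]; first by rewrite addr_ge0.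
have P0 : 0 <= enorm h `^ s by exact: powR_ge0.
have [h0|h0] := eqVneq (enorm h) 0.
  by rewrite (enorm_eq0 h0) sdiffn0 normr0 mulr_ge0 ?addr_ge0 ?powR_ge0.
have hp : 0 < enorm h by rewrite lt_neqAle eq_sym h0 enorm_ge0.
have [h1|h1] := leP (enorm h) 1.
  have := HC x (enorm h); rewrite hp h1 => /(_ isT).
  rewrite ler_pdivrMr ?powR_gt0// => HD.
  apply: le_trans (DeltaR_ub _ _ _ fM) _; apply: le_trans HD _.
  rewrite ler_wpM2r//; apply: le_trans (ler_norm C) _.
  by rewrite lerDl.
apply: le_trans (sdiffn_norm_le k h fM x) _.
rewrite mulrDl; apply: le_trans (_ : 2 ^+ k * M * enorm h `^ s <= _).
  rewrite ler_peMr// -(powRr0 (enorm h)) ler_powR ?(ltW h1)//.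
  exact: ltW.
by rewrite lerDr mulr_ge0.
Qed.

End HolderZygmund.

(** * Size of the wavelet coefficients *)

Section WaveletCoefficients.
Context {R : realType} {n : nat}.
Local Notation pt := 'rV[R]_n.
Implicit Types (x h : pt) (f g : pt -> R).
Variables (L : nat) (phi : pt -> R) (psi : nat -> pt -> R).
Hypothesis dau : daubechies L phi psi.

Definition nf (i : nat) : R := 2 `^ ((i * n)%:R / 2).

Lemma nf_gt0 i : 0 < nf i.
Proof. by rewrite powR_gt0. Qed.

Lemma nf_sqr i : nf i * nf i = (2 ^+ i) ^+ n.
Proof.
rewrite /nf -powRD; last by apply/implyP => _; rewrite pnatr_eq0.
by rewrite -splitr powR_mulrn// exprM.
Qed.

Lemma nf0 : nf 0 = 1.
Proof. by rewrite /nf mul0n mul0r powRr0. Qed.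

Lemma intv0 : intv R 0 = 0 :> pt.
Proof. by apply/rowP => i; rewrite !mxE. Qed.

Lemma phi_sqr_int : intRn (fun x => phi x ^+ 2) = 1.
Proof.
have [_ _ _ on _] := dau.
have w0 : Omega (0%N, 0%N, 0 : 'rV[int]_n) by left.
have := on _ _ w0 w0; rewrite eqxx /= => <-.
by congr intRn; apply/funext => x; rewrite intv0 subr0 expr2.
Qed.

(** The substitution y = 2^i x - k has Jacobian 2^(-in), which the two factors [nf i] cancel; what
    remains pairs a rescaled f with the fixed function [psi l]. *)
Lemma wcoef_rescale K f l i (k : 'rV[int]_n) : (1 <= l)%N -> 0 <= K ->
  continuous f -> ccn K (psi l) ->
  wcoef phi psi f (l, i, k) * nf i =
  intRn (fun y => f (2 ^- i *: y + 2 ^- i *: intv R k) * psi l y).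
Proof.
move=> l1 K0 cf cpsi.
have p2 : 0 < 2 ^+ i :> R by rewrite exprn_gt0.
pose G y := f (2 ^- i *: y + 2 ^- i *: intv R k) * psi l y.
have cG : ccn K G by apply: ccnMl => //; exact: rv_caff.
rewrite /wcoef /wav gtn_eqF//= -/(nf i).
rewrite (_ : (fun x => _) = (fun x => nf i * G (2 ^+ i *: x + - intv R k))); last first.
  apply/funext => x; rewrite /G scalerDr scalerN subrK scalerA mulVf ?gt_eqF//.
  by rewrite scale1r mulrCA.
have ca := ccn_affine (- intv R k) (lt0r_neq0 p2) cG.
rewrite (intRnZ _ _ ca); last by rewrite divr_ge0// addr_ge0.
rewrite (intRn_affine _ K0 (lt0r_neq0 p2) cG) gtr0_norm// mulrAC nf_sqr mulrA.
by rewrite divff ?mul1r// expf_neq0// gt_eqF.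
Qed.

Lemma wcoef_decay s f : 0 < s -> s < L%:R -> in_Lambda s f ->
  exists2 C : R, 0 <= C & forall l i k, Omega (l, i, k) ->
    `|wcoef phi psi f (l, i, k)| * nf i <= C * (2 `^ s) ^- i.
Proof.
move=> s0 sL Lf; have [cf [[G fG] _]] := Lf.
have G0 : 0 <= G by apply: le_trans (fG 0).
have [D D0 HD] := Lambda_sdiffn s0 Lf.
set sg := 2 `^ s; set kk := (Num.truncn s).+1 in HD.
have L0 : (0 < L)%N by rewrite -(ltr0n R); exact: lt_trans sL.
have sg1 : 1 <= sg.
  apply: le_trans (_ : 2 `^ 0 <= _); first by rewrite powRr0.
  by apply: ler_powR; rewrite ?ler1n// ltW.
have sgL : sg < 2 ^+ L.
  rewrite -powR_mulrn// /sg /powR pnatr_eq0/= ltr_expR ltr_pM2r//.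
  by rewrite ln_gt0// ltr1n.
have [Kp Kp0 cphi] := phi_ccn dau.
have I0 : 0 < intRn (@bumpf R n L).
  by apply: (bumpf_int_gt0 L0 Kp0 cphi); rewrite phi_sqr_int.
have [Bp Bp0 phiB] := ccn_bounded cphi.
have ex (l : 'I_(2 ^ n)) : exists2 C : R, 0 <= C & (1 <= l)%N ->
    forall i (k : 'rV[int]_n), `|wcoef phi psi f (l : nat, i, k)| * nf i <= C * sg ^- i.
  (* The index 0 gets a dummy constant; scaling functions are treated separately below. *)
  have [l1|l1] := leqP 1 l; last by exists 0.
  have ln : (1 <= l <= 2 ^ n - 1)%N by rewrite l1/= subn1 -ltnS prednK ?expn_gt0// ltn_ord.
  have [K K0 cpsi] := psi_ccn dau ln.
  have [_ _ mom_psi _ _] := dau.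
  have LL : (0 < L <= L)%N by rewrite L0 leqnn.
  (* Used with as many levels as the scale index i: rescaled differences over steps 2^t are at most
     D' sg^-i sg^t. *)
  have [C C0 HC] := pairing_decay K0 cpsi (mom_psi _ ln) LL I0 kk sg1 sgL.
  pose D' := D * n%:R `^ s.
  exists (C * (D' + G)) => [|_ i k]; first by rewrite mulr_ge0// addr_ge0// mulr_ge0// powR_ge0.
  rewrite -[nf i]ger0_norm ?(ltW (nf_gt0 i))// -normrM (wcoef_rescale _ _ l1 K0 cf cpsi).
  have p2 : 0 < 2 ^+ i :> R by rewrite exprn_gt0.
  have sgi : 0 <= sg ^- i by rewrite invr_ge0 exprn_ge0// powR_ge0.
  rewrite -mulrA mulrDl.
  apply: HC => //.
  - exact: rv_caff.
  - by rewrite !mulr_ge0// powR_ge0.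
  move=> t h x ht; rewrite sdiffn_affine; apply: le_trans (HD _ _) _.
  rewrite /D' -!mulrA ler_wpM2l//.
  apply: (@le_trans _ _ ((n%:R * (2 ^- i * 2 ^+ t)) `^ s)).
    have nn : 0 <= n%:R * (2 ^- i * 2 ^+ t) :> R.
      by rewrite mulr_ge0// mulr_ge0 ?invr_ge0// exprn_ge0.
    have le : enorm (2 ^- i *: h) <= n%:R * (2 ^- i * 2 ^+ t).
      apply: le_trans (enorm_le _) _; rewrite ler_wpM2l// normrZ.
      by rewrite ger0_norm ?invr_ge0 ?(ltW p2)// ler_wpM2l ?invr_ge0 ?(ltW p2).
    by apply: ge0_ler_powR; rewrite ?nnegrE ?enorm_ge0 ?(ltW s0).
  rewrite !powRM ?mulr_ge0 ?invr_ge0 ?exprn_ge0//.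
  by rewrite powRVx// !powR_expn.
pose C l := s2val (cid2 (ex l)).
have C0 l : 0 <= C l by exact: (s2valP (cid2 (ex l))).
have HC l := s2valP' (cid2 (ex l)).
pose C1 := (2 * Kp) ^+ n * (G * Bp).
have C10 : 0 <= C1 by rewrite mulr_ge0 ?exprn_ge0 ?mulr_ge0.
exists (C1 + \sum_l C l) => [|l i k O]; first by rewrite addr_ge0// sumr_ge0.
have sgi : 0 <= sg ^- i by rewrite invr_ge0 exprn_ge0// powR_ge0.
rewrite mulrDl.
(* Scaling functions occur only at i = 0, where no decay is claimed and boundedness of f is
   enough. *)
have [/= l0|l0] := eqVneq l 0%N.
  have i0 : i = 0%N.
    by case: O => -[] /=; rewrite l0.
  rewrite l0 i0 nf0 expr0 invr1 !mulr1; apply: le_trans (_ : C1 <= _); last first.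
    by rewrite lerDl sumr_ge0.
  rewrite /wcoef /wav eqxx.
  pose F y := f (y + intv R k) * phi y.
  have cF : ccn Kp F by apply: ccnMl => //; exact: rv_ctrans.
  rewrite (_ : (fun x => _) = (fun x => F (x - intv R k))); last first.
    by apply/funext => x; rewrite /F subrK.
  rewrite (intRn_trans _ Kp0 cF); apply: intRn_bound => // x.
  by rewrite normrM; apply: ler_pM.
have lO := Omega_gt0 O l0; rewrite /= in lO.
have l2 : (l < 2 ^ n)%N.
  by case/andP: lO => _; rewrite subn1 => /leq_ltn_trans; apply; rewrite prednK ?expn_gt0.
apply: le_trans (HC (Ordinal l2) _ i k) _; first by case/andP: lO.
apply: ler_wpDl; first by rewrite mulr_ge0.
by rewrite ler_wpM2r// (bigD1 (Ordinal l2))//= lerDl sumr_ge0.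
Qed.

End WaveletCoefficients.

(** * Sums over scales *)

Section ScaleSums.
Context {R : realType}.
Implicit Types (q A : R) (i j : nat).

(** This is |i - j|: one of the two truncated differences is 0. *)
Definition sdist i j : nat := (i - j + (j - i))%N.

Lemma sdist_le i j m : (sdist i j <= m)%N -> (i <= j + m)%N /\ (j <= i + m)%N.
Proof.
by move=> ijm; split;
  [apply: leq_trans (_ : j + sdist i j <= _)%N | apply: leq_trans (_ : i + sdist i j <= _)%N];
  rewrite ?leq_add2l// -leq_subLR ?leq_addr ?leq_addl.
Qed.

(** Two geometric series, one on each side of j. *)
Lemma sum_sdist q I j : 0 <= q -> q < 1 ->
  \sum_(i < I) q ^+ sdist i j <= 2 * (1 - q)^-1.
Proof.
move=> q0 q1; rewrite -(big_mkord predT (fun i => q ^+ sdist i j)).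
apply: (@le_trans _ _ (\sum_(0 <= i < j + I) q ^+ sdist i j)).
  rewrite (@big_cat_nat _ _ _ I 0 (j + I))//= ?leq_addl//.
  by rewrite lerDl sumr_ge0// => i _; rewrite exprn_ge0.
rewrite (@big_cat_nat _ _ _ j 0 (j + I))//= ?leq_addr// mulr_natl mulr2n.
apply: lerD.
  rewrite big_mkord (reindex_inj rev_ord_inj)/=.
  apply: le_trans (@geo_sum_le R q j q0 q1); apply: ler_sum => i _.
  have ij : (j - i.+1 <= j)%N by exact: leq_subr.
  rewrite /sdist (eqP ij) add0n subKn//.
  by rewrite exprS ler_piMl ?exprn_ge0// ltW.
rewrite -{1}[j]add0n big_addn addKn big_mkord.
apply: le_trans (@geo_sum_le R q I q0 q1); apply: ler_sum => i _.
have ji : (j - (i + j) = 0)%N by apply/eqP; rewrite subn_eq0 leq_addl.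
by rewrite /sdist addnK ji addn0.
Qed.

(** Terms are grouped by scale. Only nonzero terms are counted, so F may be an arbitrarily long
    list. *)
Lemma scale_sum (T : eqType) (F : seq T) (sc : T -> nat) (t : T -> R)
    (v : nat -> R) (N : nat) (V : R) :
  (forall i, (count (fun w => (sc w == i) && (t w != 0)%R) F <= N)%N) ->
  (forall w, w \in F -> t w <= v (sc w)) -> (forall i, 0 <= v i) ->
  (forall I, \sum_(i < I) v i <= V) ->
  \sum_(w <- F) t w <= N%:R * V.
Proof.
move=> cN tv v0 vV; pose I := (\max_(w <- F) sc w).+1.
have scI w : w \in F -> (sc w < I)%N.
  by move=> wF; rewrite ltnS; exact: (@leq_bigmax_seq _ _ xpredT sc).
apply: le_trans (ler_wpM2l (ler0n _ N) (vV I)); rewrite mulr_sumr.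
apply: (@le_trans _ _ (\sum_(i < I) \sum_(w <- F) (if sc w == i then t w else 0))).
  rewrite exchange_big/= big_seq [leRHS]big_seq; apply: ler_sum => w wF.
  rewrite (bigD1 (Ordinal (scI w wF)))//= eqxx big1 ?addr0// => i /negPf iw.
  by rewrite ifF//; apply/negbTE; move: iw; rewrite eq_sym => /negbT.
apply: ler_sum => i _.
apply: (@le_trans _ _ (\sum_(w <- F) (if (sc w == i) && (t w != 0) then v i else 0))).
  rewrite big_seq [leRHS]big_seq; apply: ler_sum => w wF.
  have [<-|//] := eqVneq (sc w) i; rewrite /=.
  by have [->//|_] := eqVneq (t w) 0; exact: tv.
rewrite -big_mkcond/= big_const_seq iter_addr_0 -[_ *+ count _ _]mulr_natl.
by rewrite ler_wpM2r// ler_nat.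
Qed.

Lemma expr_small q (e : R) : 0 <= q -> q < 1 -> 0 < e -> exists m, q ^+ m <= e.
Proof.
move=> q0 q1 e0.
have /cvgrPdist_le/(_ _ e0)[m _ Hm] : (q ^+ n @[n --> \oo] --> (0 : R)).
  by apply: cvg_expr; rewrite ger0_norm.
exists m; have := Hm m (leqnn m).
by rewrite sub0r normrN ger0_norm// exprn_ge0.
Qed.

End ScaleSums.

(** * Uniform bounds for the generating functions *)

Section Atoms.
Context {R : realType} {n : nat}.
Local Notation pt := 'rV[R]_n.
Implicit Types (x h z : pt) (f g : pt -> R).
Variables (L : nat) (phi : pt -> R) (psi : nat -> pt -> R).
Hypothesis dau : daubechies L phi psi.

Definition atom (l : nat) : pt -> R := if l == 0%N then phi else psi l.

(** One formula for both kinds of wavelets: for l = 0 the scale is 0 and the normalisation is 1. *)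
Lemma wav_atom l i (k : 'rV[int]_n) : Omega (l, i, k) ->
  wav phi psi (l, i, k) = (fun x => @nf R n i * atom l (2 ^+ i *: x + - intv R k)).
Proof.
rewrite /wav /atom => O; case: eqP => // l0.
have -> : i = 0%N by case: O => -[] /=; rewrite l0.
by apply/funext => x; rewrite nf0 expr0 scale1r mul1r.
Qed.

Lemma Omega_lt l i (k : 'rV[int]_n) : Omega (l, i, k) -> (l < 2 ^ n)%N.
Proof.
move=> [[/= -> _]|/= /andP[_]]; first by rewrite expn_gt0.
by rewrite subn1 => /leq_ltn_trans; apply; rewrite prednK ?expn_gt0.
Qed.

Lemma atom_CL l : (l < 2 ^ n)%N -> CL L (atom l) /\ exists2 K, 0 <= K & ccn K (atom l).
Proof.
move=> l2; rewrite /atom; case: eqP => [_|/eqP l0].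
  by split; [case: dau => -[]|exact: phi_ccn dau].
have ln : (1 <= l <= 2 ^ n - 1)%N by rewrite lt0n l0/= subn1 -ltnS prednK ?expn_gt0.
by split; [case: dau => _ /(_ l ln)[]|exact: psi_ccn dau _ ln].
Qed.

Lemma atoms_uniform (r : nat) : exists K D : R, [/\ 0 <= K, 0 <= D &
  forall l, (l < 2 ^ n)%N -> ccn K (atom l) /\
    forall h x, `|sdiffn r h (atom l) x| <= D /\
      `|sdiffn r h (atom l) x| <= D * `|h| ^+ minn r L].
Proof.
have ex (l : 'I_(2 ^ n)) : exists KD : R * R, [/\ 0 <= KD.1, 0 <= KD.2,
    ccn KD.1 (atom l) & forall h x, `|sdiffn r h (atom l) x| <= KD.2 /\
      `|sdiffn r h (atom l) x| <= KD.2 * `|h| ^+ minn r L].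
  have [CLl [K K0 cK]] := atom_CL (ltn_ord l).
  have [B B0 HB] := ccn_bounded cK.
  have [C C0 HC] := sdiffn_smooth (CL_le (geq_minr r L) CLl) cK.
  pose D1 := 2 ^+ r * B; pose D2 := 2 ^+ (r - minn r L) * C.
  have D10 : 0 <= D1 by rewrite mulr_ge0// exprn_ge0.
  have D20 : 0 <= D2 by rewrite mulr_ge0// exprn_ge0.
  exists (K, D1 + D2); split => //=; first by rewrite addr_ge0.
  move=> h x; split.
    by apply: le_trans (sdiffn_norm_le r h HB x) _; rewrite lerDl.
  (* Only L differences can profit from smoothness; the remaining ones each cost a factor 2. *)
  have rE : r = (r - minn r L + minn r L)%N by rewrite subnK// geq_minl.
  rewrite {1}rE sdiffnD.
  apply: le_trans (sdiffn_norm_le _ _ (HC h) x) _.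
  by rewrite mulrA ler_wpM2r ?exprn_ge0// lerDr.
pose KD l := sval (cid (ex l)); have HKD l := svalP (cid (ex l)).
have K0 l : 0 <= (KD l).1 by case: (HKD l).
have D0 l : 0 <= (KD l).2 by case: (HKD l).
exists (\sum_l (KD l).1), (\sum_l (KD l).2); split; [exact: sumr_ge0..|].
move=> l l2; pose o := Ordinal l2; have [_ _ cK H] := HKD o.
have leD : (KD o).2 <= \sum_l (KD l).2 by rewrite (bigD1 o)//= lerDl sumr_ge0.
split.
  by apply: ccnW cK; rewrite (bigD1 o)//= lerDl sumr_ge0.
move=> h x; have [h1 h2] := H h x; split; first exact: le_trans h1 leD.
by apply: le_trans h2 _; rewrite ler_wpM2r// exprn_ge0.
Qed.

(* For fixed [i], [z], [h] the cubes contributing at [z] are those whose index is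
   within [K] of one of the r+1 sample points, so their number is bounded
   independently of the scale. *)
Lemma near_count (K : R) (r : nat) : 0 <= K -> exists N : nat,
  forall (F : seq (windex n)) (i : nat) (h z : pt), uniq F ->
  (forall w, w \in F -> Omega w) ->
  (count (fun w : windex n => (w.1.2 == i) &&
     `[< exists p : 'I_r.+1,
          (`|2 ^+ i *: (z + (p%:R - r%:R / 2) *: h) - intv R w.2| <= K)%R >]) F <= N)%N.
Proof.
move=> K0; pose N1 := (Num.truncn K).+2.
pose T := ('I_r.+1 * 'I_(2 ^ n) * {ffun 'I_n -> 'I_(N1.*2).+1})%type.
exists #|{: T}| => F i h z uF FO.
pose X (p : 'I_r.+1) : pt := 2 ^+ i *: (z + (p%:R - r%:R / 2) *: h).
(* A contributing index is recovered from the sample point, the type of wavelet and the offset of k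
   from the floor of that point, which lies in [-N1, N1] because K + 1 < N1. *)
pose G (a : T) : windex n := (a.1.2 : nat, i,
  \row_(c < n) (Num.floor (X a.1.1 ord0 c) + (a.2 c : nat)%:Z - N1%:Z)).
rewrite -size_filter -(size_codom G).
apply: uniq_leq_size; first exact: filter_uniq.
move=> [[l i'] k]; rewrite mem_filter/= => /andP[/andP[/eqP -> /asboolP[p pK]] /FO O].
apply/codomP.
exists (p, Ordinal (Omega_lt O), [ffun c => inord `|(k ord0 c - Num.floor (X p ord0 c) + N1%:Z)%R|%N]).
congr (_, _, _); apply/rowP => c; rewrite [RHS]mxE ffunE /=.
set fl := Num.floor _.
have kc : `|X p ord0 c - (k ord0 c)%:~R| <= K.
  by have := le_trans (rv_norm_coord _ c) pK; rewrite !mxE.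
have f1 : fl%:~R <= X p ord0 c by exact: floor_le.
have f2 : X p ord0 c < fl%:~R + 1 by rewrite -intrD1; exact: floorD1_gt.
have K1 : K + 1 < N1%:R.
  have := truncnS_gt K; rewrite /N1 -[in X in _ -> _ < X]natr1; lra.
move: kc; rewrite ler_norml => /andP[k1 k2].
have b1 : 0 <= k ord0 c - fl + N1%:Z.
  rewrite -(ler0z R) rmorphD rmorphB/= -[(Posz N1)%:~R]/(N1%:R : R); lra.
have b2 : k ord0 c - fl + N1%:Z <= (N1.*2)%:Z.
  rewrite -(ler_int R) rmorphD rmorphB/= -[(Posz N1)%:~R]/(N1%:R : R).
  rewrite -[(Posz N1.*2)%:~R]/(N1.*2%:R : R) -addnn natrD; lra.
rewrite inordK; last by rewrite ltnS -lez_nat gez0_abs.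
by rewrite gez0_abs//; ring.
Qed.

End Atoms.

(** * Hyperbolic distance to dyadic boxes *)

Section Hyperbolic.
Context {R : realType} {n : nat}.
Local Notation pt := 'rV[R]_n.

(** A crude linear bound from ln v <= v - 1 is enough, as only finiteness of the radius matters. *)
Lemma arccosh_lt (t H : R) : 1 <= t -> t <= 1 + H -> arccosh t < 2 * (1 + H) + 1.
Proof.
move=> t1 tH; rewrite /arccosh; set u := Num.sqrt _.
have u0 : 0 <= u by exact: sqrtr_ge0.
have ut : u <= t.
  rewrite -[leRHS]ger0_norm; last by lra.
  by rewrite -sqrtr_sqr; apply: ler_wsqrtr; lra.
have tu : 0 < t + u by lra.
have : ln (t + u) <= t + u - 1.
  by have := @le_ln1Dx R (t + u - 1); rewrite subrKC; apply; lra.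
by lra.
Qed.

Lemma corner_Tbox i (k : 'rV[int]_n) : Tbox i k (2 ^- i *: intv R k, 2 ^- i).
Proof.
have p2 : 0 < 2 ^+ i :> R by rewrite exprn_gt0.
split => /=; last first.
  by rewrite lexx andbT ltr_pdivrMr// ltr_pMr ?invr_gt0// ltr1n.
by move=> c; rewrite !mxE mulrA divff ?gt_eqF// mul1r lexx/= ltrDl.
Qed.

(** The scales 2^-j and 2^-i differ by a factor of at most 2^m and y > 2^-j / 2, so the squared
    Euclidean distance is bounded by a multiple of the product of the heights. *)
Lemma hrho_corner (x : pt) (y A : R) (i j m : nat) (k : 'rV[int]_n) :
  0 <= A -> (sdist i j <= m)%N -> 2 ^- j.+1 < y <= 2 ^- j ->
  `|x - 2 ^- i *: intv R k| <= A * (2 ^- j + 2 ^- i) ->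
  hrho (x, y) (2 ^- i *: intv R k, 2 ^- i) <
    2 * (1 + ((n%:R * A ^+ 2 + 1) * (1 + 2 ^+ m) ^+ 2 * 2 ^+ m)) + 1.
Proof.
move=> A0 ijm /andP[y1 y2] xA.
pose a : R := 2 ^- j; pose b : R := 2 ^- i.
have a0 : 0 < a by rewrite invr_gt0 exprn_gt0.
have b0 : 0 < b by rewrite invr_gt0 exprn_gt0.
have pos2 t : 0 < 2 ^+ t :> R by rewrite exprn_gt0.
have le2 (t u : nat) : (t <= u)%N -> 2 ^+ t <= 2 ^+ u :> R.
  by move=> tu; apply: ler_weXn2l => //; rewrite ler1n.
have [ijm1 ijm2] := sdist_le ijm.
have ba : b <= 2 ^+ m * a.
  rewrite /a /b ler_pdivlMr// mulrC ler_pdivrMr// -exprD addnC.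
  exact: le2.
have ab : a <= 2 ^+ m * b.
  rewrite /a /b ler_pdivlMr// mulrC ler_pdivrMr// -exprD.
  by apply: le2; rewrite addnC.
have ya : a / 2 < y by rewrite /a -invfM -exprSr.
have y0 : 0 < y by apply: lt_trans ya; rewrite divr_gt0.
have den : 0 < 2 * y * b by rewrite !mulr_gt0.
apply: arccosh_lt; rewrite /=.
  by rewrite lerDl divr_ge0 ?(ltW den)// addr_ge0// sqr_ge0.
rewrite lerD2l ler_pdivrMr//.
have N1 : `|x - 2 ^- i *: intv R k| ^+ 2 <= (A * (a + b)) ^+ 2.
  by rewrite ler_sqr ?nnegrE// mulr_ge0// addr_ge0// ltW.
have E := le_trans (enorm_sqr_le _) (ler_wpM2l (ler0n R n) N1).
have Y : (y - b) ^+ 2 <= (a + b) ^+ 2.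
  rewrite -real_normK ?num_real// ler_sqr ?nnegrE ?addr_ge0 ?(ltW a0) ?(ltW b0)//.
  by rewrite ler_norml; apply/andP; split; rewrite /a /b in y2 a0 b0 *; lra.
apply: le_trans (lerD E Y) _.
have ab2 : (a + b) ^+ 2 <= (1 + 2 ^+ m) ^+ 2 * 2 ^+ m * (a * b).
  have m0 := pos2 m.
  have ab1 : a + b <= (1 + 2 ^+ m) * a by rewrite mulrDl mul1r lerD2l.
  apply: le_trans (_ : ((1 + 2 ^+ m) * a) ^+ 2 <= _).
    by rewrite ler_sqr ?nnegrE ?mulr_ge0 ?addr_ge0 ?(ltW a0) ?(ltW b0) ?(ltW m0).
  rewrite exprMn -[leRHS]mulrA ler_wpM2l ?sqr_ge0// expr2 mulrCA ler_wpM2l//.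
  exact: ltW.
have den2 : a * b <= 2 * y * b by rewrite ler_wpM2r ?(ltW b0)//; lra.
have P0 : 0 <= (n%:R * A ^+ 2 + 1) by rewrite addr_ge0// mulr_ge0// sqr_ge0.
have Q0 : 0 <= (1 + 2 ^+ m) ^+ 2 * 2 ^+ m :> R by rewrite mulr_ge0 ?sqr_ge0// ltW.
apply: le_trans (_ : (n%:R * A ^+ 2 + 1) * (a + b) ^+ 2 <= _).
  by rewrite exprMn mulrA mulrDl mul1r.
apply: le_trans (_ : (n%:R * A ^+ 2 + 1) *
    ((1 + 2 ^+ m) ^+ 2 * 2 ^+ m * (2 * y * b)) <= _).
  by rewrite ler_wpM2l//; apply: le_trans ab2 _; rewrite ler_wpM2l.
by rewrite !mulrA.
Qed.

End Hyperbolic.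

(** * Localisation and conclusion *)

Section Localisation.
Context {R : realType} {n : nat}.
Local Notation pt := 'rV[R]_n.
Implicit Types (x h z : pt) (f g : pt -> R).
Variables (L : nat) (phi : pt -> R) (psi : nat -> pt -> R).
Hypothesis dau : daubechies L phi psi.

Lemma wav_support (K : R) w z : (forall l, (l < 2 ^ n)%N -> ccn K (atom phi psi l)) ->
  Omega w -> wav phi psi w z != 0 -> `|2 ^+ w.1.2 *: z - intv R w.2| <= K.
Proof.
case: w => -[l i] k cK O; rewrite (wav_atom _ _ O) /= leNgt => nz; apply/negP => Kz.
move: nz; rewrite (cK l (Omega_lt O)).2 ?mulr0 ?eqxx//.
Qed.

Lemma cutoff (rho : R) : 0 <= rho ->
  exists2 chi : pt -> R, ccn (rho + 1) chi & forall z, `|z| <= rho -> chi z = 1.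
Proof.
move=> rho0; exists (fun z => Num.max 0 (1 - Num.max 0 (`|z| - rho))); last first.
  move=> z zr; rewrite (_ : Num.max 0 (`|z| - rho) = 0); last by apply/max_idPl; lra.
  by rewrite subr0; apply/max_idPr.
split.
  apply: rv_cmax0; apply: rv_cD; first exact: rv_cst.
  apply: rv_cN; apply: rv_cmax0; apply: rv_cD; last exact: rv_cst.
  by move=> z; exact: norm_continuous.
move=> z rz; apply/max_idPl; rewrite subr_le0 le_max; apply/orP; right; lra.
Qed.

(* The bound is tested against Delta_h^r of the bump phi(a(. - x))^2, whose
   integral is positive because phi has L^2 norm 1; multiplying f by a cutoff
   changes none of the coefficients that pair nontrivially with it, so Parseval
   applies although f itself need not be square integrable. *)
Lemma sdiffn_le_wavelet_sum f x h r (B d : R) : continuous f -> 0 < d ->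
  (forall z, `|x - z| <= d -> forall F : seq (windex n), uniq F ->
    (forall w, w \in F -> Omega w) ->
    \sum_(w <- F) `|wcoef phi psi f w| * `|sdiffn r h (wav phi psi w) z| <= B) ->
  `|sdiffn r h f x| <= B.
Proof.
move=> cf d0 HB; rewrite leNgt; apply/negP => BS.
pose S := sdiffn r h f.
have cS : continuous S by exact: sdiffn_continuous.
(* Midway between B and |S x|: near x, S keeps its sign and stays at least B' in absolute value,
   which contradicts the upper bound B. *)
pose B' := (B + `|S x|) / 2.
have BB' : B < B' by rewrite /B' /S; lra.
have e0 : 0 < `|S x| - B' by rewrite /B' /S; lra.
have /rv_continuousP/(_ _ e0)[d1 d10 dH] := cS x.
pose rho0 := Num.min d (d1 / 2).
have rho00 : 0 < rho0 by rewrite lt_min d0 divr_gt0.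
have rho0d : rho0 <= d by rewrite ge_min lexx.
have rho0d1 : rho0 < d1.
  by apply: le_lt_trans (_ : d1 / 2 < _); [rewrite ge_min lexx orbT|lra].
have [Kp Kp0 cphi] := phi_ccn dau.
have c2 : ccn Kp (fun x => phi x ^+ 2).
  by have := ccnMl cphi cphi.1; congr (ccn Kp _); apply/funext => z; rewrite expr2.
(* Contracts the support of phi^2 to within [rho0] of x. *)
pose a := (Kp + 1) / rho0.
have a0 : 0 < a by rewrite divr_gt0// ltr_wpDl.
pose th z := phi (a *: z + - (a *: x)) ^+ 2.
have cth := ccn_affine (- (a *: x)) (lt0r_neq0 a0) c2; rewrite -/th in cth.
set Kt := (Kp + _) / _ in cth.
have Kt0 : 0 <= Kt by rewrite divr_ge0// addr_ge0.
have th0 z : 0 <= th z by exact: sqr_ge0.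
have thz z : th z != 0 -> `|x - z| <= rho0.
  move=> nz; have : `|a *: z + - (a *: x)| <= Kp.
    rewrite leNgt; apply/negP => Kz; move: nz.
    by rewrite /th cphi.2// expr0n eqxx.
  rewrite -scalerBr normrZ gtr0_norm// distrC mulrC -ler_pdivlMr// => /le_trans; apply.
  rewrite /a invf_div mulrCA ler_piMr ?(ltW rho00)//.
  by rewrite ler_pdivrMr ?ltr_wpDl// mul1r lerDl.
have Ith : 0 < intRn th.
  rewrite (intRn_affine _ Kp0 (lt0r_neq0 a0) c2) (phi_sqr_int dau) mulr1.
  by rewrite invr_gt0 exprn_gt0// normr_gt0 gt_eqF.
pose Th := sdiffn r h th.
have cTh : ccn (Kt + r%:R * `|h|) Th by exact: sdiffn_ccn.
set K1 := Kt + _ in cTh.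
have K10 : 0 <= K1 by rewrite addr_ge0// mulr_ge0.
have [K [D0 [K0 _ HK]]] := atoms_uniform dau 0.
have cK l : (l < 2 ^ n)%N -> ccn K (atom phi psi l) by move=> /HK[].
(* The support of a wavelet has diameter at most 2K because its scale is at most 1; one that meets
   the support of [Th] thus lies where the cutoff equals 1. *)
pose rho := K1 + 2 * K.
have rho_ge0 : 0 <= rho by rewrite addr_ge0// mulr_ge0.
have K1rho : K1 <= rho by rewrite lerDl mulr_ge0.
have [chi cchi chi1] := cutoff rho_ge0.
pose g z := f z * chi z.
have cg : ccn (rho + 1) g by exact: ccnMl.
have cTh' : ccn (rho + 1) Th by apply: ccnW cTh; rewrite (le_trans K1rho)// lerDl.
have r1 : 0 <= rho + 1 by rewrite addr_ge0.
have E1 : intRn (fun z => g z * Th z) = intRn (fun z => f z * Th z).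
  congr intRn; apply/funext => z; rewrite /g.
  have [zK|zK] := leP `|z| K1; last by rewrite cTh.2// !mulr0.
  by rewrite chi1 ?mulr1// (le_trans zK).
have low : B' * intRn th <= `|intRn (fun z => f z * Th z)|.
  rewrite (intRn_sdiffn _ _ Kt0 cf cth) normrM normrX normrN1 expr1n mul1r.
  pose kap : R := if 0 <= S x then 1 else - 1.
  have kap1 : `|kap| = 1 by rewrite /kap; case: ifP => _; rewrite ?normrN1 ?normr1.
  have kS : kap * S x = `|S x|.
    rewrite /kap; case: leP => Sx; first by rewrite mul1r ger0_norm.
    by rewrite mulN1r ltr0_norm.
  rewrite -[leRHS]mul1r -kap1 -normrM.
  apply: le_trans (ler_norm _).
  have cS' : ccn Kt (fun z => th z * S z) by exact: ccnMr.
  rewrite -(intRnZ _ Kt0 cth) -(intRnZ _ Kt0 cS').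
  apply: (intRn_le Kt0 (ccnZ _ cth) (ccnZ _ cS')) => z.
  have [->|nz] := eqVneq (th z) 0; first by rewrite mul0r !mulr0.
  rewrite [leRHS]mulrCA [leLHS]mulrC ler_wpM2l//.
  have := dH z (le_lt_trans (thz z nz) rho0d1) => Sxz.
  have : kap * (S x - S z) <= `|S x - S z|.
    by rewrite -[leRHS]mul1r -kap1 -normrM ler_norm.
  by rewrite mulrBr kS; lra.
have up : `|intRn (fun z => g z * Th z)| <= B * intRn th.
  apply: (parseval_norm_le dau r1 cg cTh') => F uF FO.
  have cs w : Omega w -> continuous (fun z => `|sdiffn r h (wav phi psi w) z|).
    move=> O z; apply: (@continuous_comp _ _ _ (sdiffn r h (wav phi psi w))).
      by apply: sdiffn_continuous; exact: wav_continuous dau _ O.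
    exact: norm_continuous.
  (* The value 0 off F gives all indices a common support, as [intRn_sum] requires. *)
  pose G w := if w \in F then
    (fun z => th z * (`|wcoef phi psi f w| * `|sdiffn r h (wav phi psi w) z|))
    else (fun=> 0).
  have cG w : ccn Kt (G w).
    rewrite /G; case: ifP => [/FO O|_]; last exact: ccn0.
    by apply: ccnMr => //; apply: rv_cZ; exact: cs.
  apply: (@le_trans _ _ (\sum_(w <- F) intRn (G w))); last first.
    rewrite -(intRn_sum _ Kt0 cG) -(intRnZ _ Kt0 cth).
    apply: (intRn_le Kt0 (ccn_sum F cG) (ccnZ _ cth)) => z.
    rewrite (_ : \sum_(w <- F) _ = th z * \sum_(w <- F)
      `|wcoef phi psi f w| * `|sdiffn r h (wav phi psi w) z|); last first.
      rewrite mulr_sumr big_seq [RHS]big_seq; apply: eq_bigr => w wF.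
      by rewrite /G wF.
    have [->|nz] := eqVneq (th z) 0; first by rewrite mul0r mulr0.
    rewrite mulrC ler_wpM2r//; apply: HB => //.
    exact: le_trans (thz z nz) rho0d.
  rewrite big_seq [leRHS]big_seq; apply: ler_sum => w wF.
  have O := FO w wF; have cw := wav_continuous dau O.
  have G0 : 0 <= intRn (G w).
    apply: (intRn_ge0 Kt0 (cG w)) => z; rewrite /G wF.
    by apply: mulr_ge0 => //; apply: mulr_ge0.
  have [->|nT] := eqVneq (wcoef phi psi Th w) 0; first by rewrite mulr0 normr0.
  (* A nonzero coefficient of [Th] yields a point where the wavelet meets its support, so cutting f
     off leaves the coefficient of f unchanged. *)
  have [z0 z0n] : exists z0, Th z0 * wav phi psi w z0 != 0.
    apply/not_existsP => H; move/eqP: nT; apply; rewrite /wcoef -[RHS](@intRn0 R n).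
    congr intRn; apply/funext => z; apply/eqP.
    by have /negP := H z; rewrite negbK.
  move: z0n; rewrite mulf_eq0 negb_or => /andP[Tz0 wz0].
  have z0K : `|z0| <= K1.
    by rewrite leNgt; apply/negP => /cTh.2 T0; rewrite T0 eqxx in Tz0.
  have -> : wcoef phi psi g w = wcoef phi psi f w.
    rewrite /wcoef; congr intRn; apply/funext => z.
    have [->|wz] := eqVneq (wav phi psi w z) 0; first by rewrite !mulr0.
    rewrite /g chi1 ?mulr1//.
    have h1 := wav_support cK O wz; have h2 := wav_support cK O wz0.
    have h3 : `|2 ^+ w.1.2 *: (z - z0)| <= 2 * K.
      rewrite scalerBr -(subrKA (intv R w.2)).
      apply: le_trans (ler_normD _ _) _; rewrite [`|intv _ _ - _|]distrC; lra.
    have h4 : `|z - z0| <= 2 * K.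
      apply: le_trans h3; rewrite normrZ ler_peMl//.
      by rewrite ger0_norm ?exprn_ge0//; apply: exprn_ege1; rewrite ler1n.
    by have := ler_normD (z - z0) z0; rewrite subrK /rho; lra.
  rewrite normrM.
  have -> : intRn (G w) = `|wcoef phi psi f w| *
      intRn (fun z => th z * `|sdiffn r h (wav phi psi w) z|).
    rewrite -(intRnZ _ Kt0 (ccnMr cth (cs w O))); congr intRn; apply/funext => z.
    by rewrite /G wF mulrCA.
  rewrite ler_wpM2l//.
  have -> : wcoef phi psi Th w = intRn (fun z => wav phi psi w z * Th z).
    by congr intRn; apply/funext => z; rewrite mulrC.
  rewrite (intRn_sdiffn _ _ Kt0 cw cth) normrM normrX normrN1 expr1n mul1r.
  apply: le_trans (intRn_norm Kt0 (ccnMr cth _)) _.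
    exact: sdiffn_continuous.
  rewrite (_ : (fun z => `|_|) = (fun z => th z * `|sdiffn r h (wav phi psi w) z|))//.
  by apply/funext => z; rewrite normrM ger0_norm.
rewrite E1 in up; have := le_trans low up.
by rewrite ler_pM2r// leNgt BB'.
Qed.

End Localisation.

Theorem mainTheorem10 (R : realType) (n : nat) (L : nat)
    (phi : 'rV[R]_n -> R) (psi : nat -> 'rV[R]_n -> R) (s : R) (r : nat) :
  (0 < n)%N -> daubechies L phi psi ->
  0 < s -> s < r%:R -> (r <= L.+1)%N -> s < L%:R ->
  exists c : R, 0 < c < 1 /\
    forall (f : 'rV[R]_n -> R) (eps : R), 0 < eps -> in_Lambda s f ->
    exists (m : nat) (Rr : R), 1 < Rr /\
      forall j : nat,
        Sset r j s f eps `<=`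
        \bigcup_(i in [set i : int | j%:Z - m%:Z <= i <= j%:Z + m%:Z])
           hnbhd (T0 phi psi i s f (c * eps)) Rr.
Proof.
move=> n0 dau s0 sr _ sL.
pose sg : R := 2 `^ s.
have lt_pow (u : nat) : s < u%:R -> sg < 2 ^+ u.
  move=> su; rewrite -powR_mulrn// /sg /powR pnatr_eq0/= ltr_expR ltr_pM2r//.
  by rewrite ln_gt0// ?ltr1n.
have sg1 : 1 < sg.
  have : expR 0 < sg; last by rewrite expR0.
  rewrite /sg /powR pnatr_eq0/= ltr_expR mulr_gt0//.
  by rewrite ln_gt0// ltr1n.
have sg0 : 0 < sg by exact: lt_trans sg1.
pose r' := minn r L.
have sgr : sg < 2 ^+ r' by apply: lt_pow; rewrite /r' /minn; case: ifP.
have p2r : 0 < 2 ^+ r' :> R by rewrite exprn_gt0.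
(* Decay per step of scale: the first ratio for coarse scales, where the wavelet is smooth, the
   second for fine ones, where the coefficients decay. *)
pose tau := Num.max (sg / 2 ^+ r') sg^-1.
have tau0 : 0 <= tau by rewrite le_max divr_ge0 ?(ltW sg0) ?(ltW p2r).
have tau1 : tau < 1 by rewrite gt_max ltr_pdivrMr// mul1r sgr invf_lt1.
pose q := Num.sqrt tau.
have q0 : 0 <= q by exact: sqrtr_ge0.
have qq : q * q = tau by rewrite -expr2 sqr_sqrtr.
have q1 : q < 1 by rewrite -sqrtr1 ltr_sqrt.
have [K [D [K0 D0 HA]]] := atoms_uniform dau r.
have [N HN] := @near_count R n K r K0.
(* Number of wavelets per scale, times their size, times the sum of q^|i-j| over all scales. *)
pose Z0 : R := N%:R * (D * (2 * (1 - q)^-1)).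
have Z00 : 0 <= Z0.
  by rewrite !mulr_ge0// invr_ge0 subr_ge0 ltW.
(* The 2 reserves half of the budget for the far scales, and sg pays for y being only larger than
   2^-(j+1). *)
pose c := (2 * sg * (Z0 + 1))^-1.
have Z1 : 0 < Z0 + 1 by rewrite ltr_wpDl.
have c0 : 0 < c by rewrite invr_gt0 !mulr_gt0.
have c1 : c < 1.
  rewrite invf_lt1; last by rewrite !mulr_gt0.
  have : 1 * 1 <= sg * (Z0 + 1) by apply: ler_pM; rewrite ?(ltW sg1)// lerDr.
  by rewrite -mulrA; lra.
exists c; split; first by rewrite c0 c1.
move=> f eps eps0 Lf; have [cf _] := Lf.
have [Cf Cf0 HCf] := wcoef_decay dau s0 sL Lf.
have ZC1 : 0 < Z0 * Cf + 1 by rewrite ltr_wpDl// mulr_ge0.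
(* The other half of the budget: q^m below this value makes the far scales negligible. *)
have e1 : 0 < eps / (2 * sg * (Z0 * Cf + 1)) by rewrite divr_gt0// !mulr_gt0.
have [m Hm] := expr_small q0 q1 e1.
(* Three displacements are allowed for: from x to the test point z, from z to a sample point of the
   difference, and from there to the corner of the cube. *)
pose A : R := 1 + r%:R + K.
have A0 : 0 <= A by rewrite !addr_ge0.
exists m; exists (2 * (1 + ((n%:R * A ^+ 2 + 1) * (1 + 2 ^+ m) ^+ 2 * 2 ^+ m)) + 1).
split.
  have : 0 <= (n%:R * A ^+ 2 + 1) * (1 + 2 ^+ m) ^+ 2 * 2 ^+ m :> R.
    rewrite !mulr_ge0 ?sqr_ge0 ?exprn_ge0//.
    by rewrite addr_ge0// mulr_ge0// sqr_ge0.
  lra.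
move=> j [x y] [/= y0 [ey yj]].
apply: contrapT => notin.
have ys : 0 < y `^ s by rewrite powR_gt0.
move: ey; rewrite ltr_pdivlMr// => ey.
have [h hy eh] := DeltaR_gt (ltW (mulr_gt0 eps0 ys)) ey.
have p2 (t : nat) : 0 < 2 ^+ t :> R by rewrite exprn_gt0.
have hj : `|h| <= 2 ^- j.
  by apply: le_trans (rv_norm_le_enorm h) _; rewrite hy; case/andP: yj.
have near z w : `|x - z| <= 2 ^- j -> Omega w -> sdiffn r h (wav phi psi w) z != 0 ->
    exists p : 'I_r.+1,
      `|2 ^+ w.1.2 *: (z + (p%:R - r%:R / 2) *: h) - intv R w.2| <= K.
  move=> xz O /sdiffn_neq0[p _ nz]; exists p.
  by apply: (wav_support _ O nz) => l /HA[].
(* A larger coefficient would put its box into [T0], with a corner within the chosen radius of (x,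
   y), contrary to [notin]. *)
have small z l i k : `|x - z| <= 2 ^- j -> Omega (l, i, k) ->
    sdiffn r h (wav phi psi (l, i, k)) z != 0 -> (sdist i j <= m)%N ->
    `|wcoef phi psi f (l, i, k)| * @nf R n i <= c * eps * sg ^- i.
  move=> xz O nz ijm; rewrite leNgt; apply/negP => big; apply: notin.
  have [p pK] := near z _ xz O nz; rewrite /= in pK.
  exists i%:Z.
    have [ij ji] := sdist_le ijm.
    by rewrite /= lerBlDr -!PoszD !lez_nat ij ji.
  split => //=; exists (2 ^- i *: intv R k, 2 ^- i).
    exists k; last exact: corner_Tbox.
    exists l; split => //; rewrite -(ltr_pM2r (@nf_gt0 R n i)).
    (* With |I| = 2^(-in) the threshold is 2^(-is) 2^(-in/2), and the normalisation removes the
       second factor. *)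
    suff PE : (2 ^- (i * n)) `^ (s / n%:R + 2^-1) * @nf R n i = sg ^- i.
      by apply: le_lt_trans big; rewrite -PE mulrA.
    have nR : n%:R != 0 :> R by rewrite pnatr_eq0 -lt0n.
    rewrite powRVx// -!powR_mulrn ?powR_ge0// -powRrM /nf natrM /sg -powRrM.
    rewrite -!powRN -powRD; last by apply/implyP => _; rewrite pnatr_eq0.
    by congr (_ `^ _); field.
  suff fin : `|x - 2 ^- i *: intv R k| <= A * (2 ^- j + 2 ^- i) by exact: hrho_corner A0 ijm yj fin.
  pose v := (p%:R - r%:R / 2) *: h.
  have vr : `|v| <= r%:R * 2 ^- j.
    rewrite normrZ; apply: ler_pM => //.
    have : (p : nat)%:R <= r%:R :> R by rewrite ler_nat -ltnS.
    have : 0 <= (p : nat)%:R :> R by [].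
    by move=> ? ?; rewrite ler_norml; apply/andP; split; lra.
  have zk : `|z + v - 2 ^- i *: intv R k| <= K * 2 ^- i.
    rewrite -/v in pK; rewrite ler_pdivlMr// mulrC.
    move: pK; rewrite -[X in `|X| <= _](_ : 2 ^+ i *: (z + v - 2 ^- i *: intv R k) = _).
      by rewrite normrZ ger0_norm ?exprn_ge0.
    by rewrite scalerBr scalerA divff ?scale1r// gt_eqF.
  have -> : x - 2 ^- i *: intv R k = (x - z) + (z + v - 2 ^- i *: intv R k) - v.
    by apply/rowP => c'; rewrite !mxE; ring.
  apply: le_trans (ler_normB _ _) _.
  apply: le_trans (lerD (ler_normD _ _) vr) _.
  have i0 : 0 <= 2 ^- i :> R by rewrite invr_ge0 ltW.
  have j0 : 0 <= 2 ^- j :> R by rewrite invr_ge0 ltW.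
  have := mulr_ge0 K0 j0; have := mulr_ge0 (ler0n R r) i0.
  rewrite /A !mulrDl !mulrDr !mul1r; lra.
(* One amplitude for all scales: c eps covers the near ones, Cf q^m the far ones. *)
pose AA := c * eps + Cf * q ^+ m.
have AA0 : 0 <= AA by rewrite addr_ge0 ?mulr_ge0 ?exprn_ge0 ?(ltW c0) ?(ltW eps0).
pose v (i : nat) : R := D * sg ^- j * AA * q ^+ sdist i j.
have sgj t : 0 <= sg ^- t by rewrite invr_ge0 exprn_ge0// ltW.
have v0 i : 0 <= v i by rewrite !mulr_ge0// exprn_ge0.
have le : `|sdiffn r h f x| <= Z0 * (sg ^- j * AA).
  have d0 : 0 < 2 ^- j :> R by rewrite invr_gt0.
  apply: (sdiffn_le_wavelet_sum dau cf d0) => z xz F uF FO.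
  rewrite /Z0 -mulrA.
  apply: (@scale_sum _ _ F (fun w => w.1.2) _ v) => //.
  - move=> i; apply: leq_trans (HN F i h z uF FO).
    rewrite -!size_filter; apply: uniq_leq_size; first exact: filter_uniq.
    move=> w; rewrite !mem_filter => /andP[/andP[/eqP wi]].
    rewrite mulf_eq0 negb_or => /andP[_ nz] wF; rewrite wi eqxx wF/= andbT.
    apply/asboolP; rewrite -wi; apply: near => //; first exact: FO.
    by rewrite -normr_eq0.
  - move=> [[l i] k] wF; have O := FO _ wF.
    suff : `|wcoef phi psi f (l, i, k)| * `|sdiffn r h (wav phi psi (l, i, k)) z| <= v i by [].
    have [->|nz] := eqVneq (sdiffn r h (wav phi psi (l, i, k)) z) 0.
      by rewrite normr0 mulr0.
    set a := `|wcoef _ _ _ _|.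
    have [_ HD] := HA l (Omega_lt O).
    rewrite (wav_atom _ _ O) sdiffnZ sdiffn_affine normrM.
    rewrite (ger0_norm (ltW (@nf_gt0 R n i))) mulrA.
    set b := `|sdiffn _ _ _ _|.
    have [b1 b2] : b <= D /\ b <= D * `|2 ^+ i *: h| ^+ r' by exact: HD.
    have b0 : 0 <= b by exact: normr_ge0.
    (* For i >= j the bound D on the difference suffices; for i < j smoothness gives (2^i
       2^-j)^r'. *)
    have bt : sg ^- i * b <= D * sg ^- j * tau ^+ sdist i j.
      have [ji|ij] := leqP j i.
        rewrite /sdist (eqP ji) addn0.
        have -> : sg ^- i = sg ^- j * sg^-1 ^+ (i - j).
          by rewrite exprVn -invfM -exprD subnKC.
        rewrite mulrC mulrA; apply: ler_pM.
        - by rewrite mulr_ge0.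
        - by rewrite exprn_ge0// invr_ge0 ltW.
        - by rewrite ler_wpM2r.
        by rewrite lerXn2r ?nnegrE ?invr_ge0 ?(ltW sg0)// le_max lexx orbT.
      rewrite /sdist (eqP (ltnW ij)) add0n.
      apply: (@le_trans _ _ (sg ^- i * (D * (2 ^+ i * 2 ^- j) ^+ r'))).
        rewrite ler_wpM2l//; apply: le_trans b2 _; rewrite ler_wpM2l//.
        rewrite lerXn2r ?nnegrE// ?mulr_ge0 ?invr_ge0 ?(ltW (p2 _))//.
        by rewrite normrZ ger0_norm ?(ltW (p2 _))// ler_wpM2l// ltW.
      rewrite mulrCA -[leRHS]mulrA ler_wpM2l//.
      have -> : 2 ^+ i * 2 ^- j = 2 ^- (j - i) :> R.
        by rewrite -[in LHS](subnKC (ltnW ij)) exprD invfM mulrA divff ?mul1r// gt_eqF.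
      have -> : sg ^- i = sg ^- j * sg ^+ (j - i).
        by rewrite -{1}(subnKC (ltnW ij)) exprD invfM mulfVK// expf_neq0// gt_eqF.
      rewrite -mulrA ler_wpM2l// exprVn -exprM mulnC exprM -expr_div_n.
      by rewrite lerXn2r ?nnegrE ?divr_ge0 ?(ltW sg0) ?(ltW p2r)// le_max lexx.
    have tq : tau ^+ sdist i j = q ^+ sdist i j * q ^+ sdist i j by rewrite -qq exprMn.
    have ce0 : 0 <= c * eps by rewrite mulr_ge0 ?(ltW c0) ?(ltW eps0).
    have qd0 t : 0 <= q ^+ t by rewrite exprn_ge0.
    have qd1 t : q ^+ t <= 1 by apply: exprn_ile1 => //; exact: ltW.
    (* Here C is c eps when |i - j| <= m and Cf otherwise; in the second case one of the two factors
       q^|i-j| of the power of [tau] is at most q^m. *)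
    suff [C [C0 aC tC]] : exists C : R, [/\ 0 <= C, a * @nf R n i <= C * sg ^- i &
        C * tau ^+ sdist i j <= AA * q ^+ sdist i j].
      apply: le_trans (ler_wpM2r b0 aC) _.
      apply: le_trans (_ : C * (D * sg ^- j * tau ^+ sdist i j) <= _).
        by apply: le_trans (ler_wpM2l C0 bt); rewrite [leRHS]mulrA.
      rewrite /v -[leRHS]mulrA mulrCA; apply: ler_wpM2l => //.
      by rewrite mulr_ge0.
    rewrite tq; have [ijm|ijm] := leqP (sdist i j) m.
      exists (c * eps); split => //; first exact: small xz O nz ijm.
      apply: ler_pM => //; first by rewrite mulr_ge0.
        by rewrite /AA lerDl mulr_ge0.
      by rewrite ler_piMl.
    exists Cf; split => //; first exact: HCf.
    rewrite mulrA; apply: ler_wpM2r => //; apply: ler_wpDl => //.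
    by apply: ler_wpM2l => //; apply: ler_wiXn2l; [exact: q0|exact: ltW|exact: ltnW].
  - move=> I; rewrite /v -mulr_sumr.
    rewrite [leRHS](_ : _ = D * sg ^- j * AA * (2 * (1 - q)^-1)); last by ring.
    by rewrite ler_wpM2l ?mulr_ge0//; exact: sum_sdist.
(* The lower end 2^-(j+1) of the range of y costs the extra factor sg provided for in c and m. *)
have sy : sg ^- j.+1 < y `^ s.
  rewrite /sg -powR_expn// -powRVx//; case/andP: yj => yj _.
  by apply: gt0_ltr_powR; rewrite ?nnegrE ?invr_ge0 ?(ltW y0) ?(ltW (p2 _)).
have es0 : 0 <= eps * sg^-1 / 2 by rewrite !divr_ge0 ?(ltW eps0) ?(ltW sg0).
have ZA : Z0 * AA <= eps * sg^-1.
  have a1 : Z0 * (c * eps) <= eps * sg^-1 / 2.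
    have -> : Z0 * (c * eps) = eps * sg^-1 / 2 * (Z0 / (Z0 + 1)).
      by rewrite /c; field; rewrite (gt_eqF Z1) (gt_eqF sg0).
    by rewrite ler_piMr// ler_pdivrMr// mul1r lerDl.
  have a2 : Z0 * (Cf * q ^+ m) <= eps * sg^-1 / 2.
    rewrite mulrA; apply: le_trans (ler_wpM2l (mulr_ge0 Z00 Cf0) Hm) _.
    have -> : Z0 * Cf * (eps / (2 * sg * (Z0 * Cf + 1))) =
        eps * sg^-1 / 2 * (Z0 * Cf / (Z0 * Cf + 1)).
      by field; rewrite (gt_eqF ZC1) (gt_eqF sg0).
    by rewrite ler_piMr// ler_pdivrMr// mul1r lerDl.
  rewrite /AA mulrDr; lra.
have upper : Z0 * (sg ^- j * AA) <= eps * sg ^- j.+1.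
  rewrite mulrCA; apply: le_trans (ler_wpM2l (sgj j) ZA) _.
  by rewrite mulrCA exprSr invfM.
have := lt_le_trans eh (le_trans le upper).
by rewrite ltr_pM2l// ltNge ltW.
Qed.
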